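(* Let $s\geqslant1$ and consider Kripke's schema (KS): $\exists G^m[\varphi\equiv\exists x(G(x)(0)^{m-1}\neq0)]$, where $\varphi$ is a formula of $L$, $G^m$ is not free in $\varphi$, and $m\geqslant\max(sort(\varphi),1)$. Then: (1) $LP_s+(C_s)\vdash(KS_s)$; (2) $LP+(C)\vdash(KS)$; (3) $\mathcal{B}_s\Vdash(KS_s)$ (the universal closure of every instance with types $\leqslant s$ is forced at the root).
   Context: For an $m$-functional $G$, $G(x)(0)^{m-1}$ is $G(x)(0)\cdots(0)$ with $m-1$ applications to $0$ (a number term). $sort(\varphi)$ = maximal type of free variables (0 if none). For an axiom schema $(A)$, $(A_s)$ is its version with all types $\leqslant s$. Languages: $L_s$ has variables $x,y,\dots$ (type 0), and for $1\leqslant n\leqslant s$: $F^n$ ($n$-functionals), $A^n$ (lawlike), $\mathcal F^n$ (lawless), of type $n$; constants $0,K^n$; function symbols $S,+,\cdot,N^n,Ap^n$ ($Z(t)=Ap(Z,t)$ lowers type by 1, a 1-functional applied to a term gives a term); atomic formulas $t=_0\tau$, $Z=_nV$; intuitionistic connectives and quantifiers. $L=\bigcup_sL_s$. $LP_s$ ($LP$) adds atomic formulas $\vdash_z\varphi(\bar X)$ for terms $z$ and formulas $\varphi$ of $L_s$ ($L$) with free variables in $\bar X$. Theory $LP$ (and its fragment $LP_s$ with types $\leqslant s$): intuitionistic logic with equality; axioms $Sx\neq0$, $Sx=Sy\supset x=y$, $x+0=x$, $x+Sy=S(x+y)$, $x\cdot0=0$, $x\cdot Sy=x\cdot y+x$;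 induction for all formulas; $K^{n+1}(x)=K^n$ ($K^0:=0$); $\neg(N^n(F^n)=K^n)$; $N^{n+1}(F)(x)=N^n(F(x))$; $N^n(F)=N^n(G)\supset F=G$; $\exists A^1\forall x(A(x)=t)$ for terms $t$ with only number and lawlike-1-functional variables; for $\varphi$ in $L$: (CS1) $(\vdash_z\varphi)\vee\neg(\vdash_z\varphi)$, (CS2) $(\vdash_z\varphi)\supset(\vdash_{z+y}\varphi)$, (CS3) $\exists z(\vdash_z\varphi)\equiv\varphi$. (C) is the conjunction of the closures of (C1) $\forall x\exists y\,\varphi(x,y)\supset\exists F^m\forall x\,\varphi(x,F(x)(0)^{m-1})$ for $\varphi$ in $LP$, $m\geqslant\max(sort(\varphi),1)$, and (C2) $\forall x\exists!G^n\varphi(x,G)\supset\exists F^m\forall x\,\varphi(x,F(x)(0)^{m-n-1})$ for $\varphi$ in $LP$, $m\geqslant\max(sort(\varphi),n+1)$. Beth model $\mathcal{B}_s$: path = maximal chain. $a_0=\omega$, $d_0=\{\langle x\rangle:x\in\omega^*\}$ ordered by extension ($\langle x\rangle\preccurlyeq_0\langle y\rangle$ iff $y$ is an initial segment of $x$). For $k\geqslant1$: $a_k$ = partial $f:d_{k-1}\times\omega\dashrightarrow a_{k-1}$, monotonic ($y\preccurlyeq_{k-1}x\Rightarrow f(x,\cdot)\subseteq f(y,\cdot)$) and complete (along every path of $d_{k-1}$ the union of $f(x,\cdot)$ is total); $d_k$ = tuples $\langle x_0,\dots,x_k\rangle$ of sequences of a common length $m=lh$ with $x_i\in a_i^{(m)}$,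 ordered componentwise by extension. Nodes $M=d_{s-1}$, root $\varepsilon$, $\bar\alpha(k)=\langle\alpha_0,\dots,\alpha_{k-1}\rangle$. Domains $\omega$, $a_k$, $b_k=\{f\in a_k:f(\text{root},\cdot)\text{ total}\}$, $l_k=\{\nu_k(\xi)\}$ where $\xi:\omega\times a_{k-1}\to a_{k-1}$ has all $\xi(n,\cdot)$ bijective and $\nu_k(\xi)(x,n)=\xi(n,\langle\langle x\rangle_{k-1}\rangle_n)$ for $n<lh(x)$, undefined otherwise. $\widehat K^1(x,n)=0$, $\widehat K^{k+1}(x,n)=\widehat K^k$; $N^k\mapsto S^k$ ($S^0(x)=x+1$, $S^{n+1}(f)=S^n\circ f$); at node $\alpha$, $Ap^k(f,n)=f(\bar\alpha(k),n)$. $Val(\alpha,Z=V)=T$ iff both values at $\alpha$ defined and equal; $Val(\alpha,\vdash_t\varphi)=T$ iff $t^{[\alpha]}$ defined and some $\gamma\succcurlyeq\alpha$ with $lh(\gamma)=t^{[\alpha]}$ forces $\varphi$. Beth forcing: atomic, $\vee$, $\exists$ require every path through $\alpha$ to meet a node where the atomic valuation holds / a disjunct / an instance is forced; $\supset$ quantifies over all later nodes; $\wedge,\forall$ pointwise; $\bot$ never forced; $\mathcal B_s\Vdash\varphi$ iff $\varepsilon\Vdash\varphi$. *)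

(* Defs.v *)
From Stdlib Require Import List Arith PeanoNat.
Import ListNotations.

(* kinds of functional variables: F^n (functionals), A^n (lawlike),
   \mathcal F^n (lawless) *)
Inductive fkind := KF | KA | KL.

(* vnum i : number variable (type 0);  vfun k n i : variable of kind k, type n *)
Inductive var := vnum (i : nat) | vfun (k : fkind) (n : nat) (i : nat).

Definition var_eq_dec : forall x y : var, {x = y} + {x <> y}.
Proof. decide equality; try apply Nat.eq_dec; decide equality. Defined.

Definition vtype (v : var) : nat := match v with vnum _ => 0 | vfun _ n _ => n end.
Definition var_ok (v : var) : Prop := match v with vnum _ => True | vfun _ n _ => 1 <= n end.

(* terms: tK n is the constant K^n (n >= 1), tN is N^n (the index n is the
   type of the argument), tAp f t is Ap^n(f,t) = f(t) *)
Inductive term :=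
| tvar (v : var)
| tzero
| tK (n : nat)
| tS (t : term)
| tplus (t u : term)
| tmult (t u : term)
| tN (t : term)
| tAp (f t : term).

Fixpoint tyof (t : term) : option nat :=
  match t with
  | tvar (vnum _) => Some 0
  | tvar (vfun _ n _) => if 1 <=? n then Some n else None
  | tzero => Some 0
  | tK n => if 1 <=? n then Some n else None
  | tS u => match tyof u with Some 0 => Some 0 | _ => None end
  | tplus u w | tmult u w =>
      match tyof u, tyof w with Some 0, Some 0 => Some 0 | _, _ => None end
  | tN u => match tyof u with Some (S n) => Some (S n) | _ => None end
  | tAp f u => match tyof f, tyof u with Some (S n), Some 0 => Some n | _, _ => None end
  end.

Fixpoint tvars (t : term) : list var :=
  match t with
  | tvar v => [v]
  | tzero | tK _ => []
  | tS u | tN u => tvars u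
  | tplus u w | tmult u w | tAp u w => tvars u ++ tvars w
  end.

Fixpoint tmax (t : term) : nat :=
  match t with
  | tvar v => vtype v
  | tzero => 0
  | tK n => n
  | tS u | tN u => tmax u
  | tplus u w | tmult u w | tAp u w => Nat.max (tmax u) (tmax w)
  end.

Fixpoint tsubst (X : var) (r : term) (t : term) : term :=
  match t with
  | tvar v => if var_eq_dec v X then r else tvar v
  | tzero => tzero
  | tK n => tK n
  | tS u => tS (tsubst X r u)
  | tplus u w => tplus (tsubst X r u) (tsubst X r w)
  | tmult u w => tmult (tsubst X r u) (tsubst X r w)
  | tN u => tN (tsubst X r u)
  | tAp u w => tAp (tsubst X r u) (tsubst X r w)
  end.

(* formulas of LP; those without Fprf are the formulas of L.
   Feq t u is t =_n u (n the common type); Fprf z phi is  |-_z phi. *)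
Inductive formula :=
| Feq (t u : term)
| Fprf (z : term) (p : formula)
| Fbot
| Fand (p q : formula)
| For (p q : formula)
| Fimp (p q : formula)
| Fall (v : var) (p : formula)
| Fex (v : var) (p : formula).

Definition Fnot (p : formula) := Fimp p Fbot.
Definition Fiff (p q : formula) := Fand (Fimp p q) (Fimp q p).

Fixpoint isL (p : formula) : Prop :=
  match p with
  | Feq _ _ | Fbot => True
  | Fprf _ _ => False
  | Fand p q | For p q | Fimp p q => isL p /\ isL q
  | Fall _ p | Fex _ p => isL p
  end.

Fixpoint wf (p : formula) : Prop :=
  match p with
  | Feq t u => exists n, tyof t = Some n /\ tyof u = Some n
  | Fprf z q => tyof z = Some 0 /\ isL q /\ wf q
  | Fbot => True
  | Fand p q | For p q | Fimp p q => wf p /\ wf q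
  | Fall v p | Fex v p => var_ok v /\ wf p
  end.

Fixpoint tbnd (s : nat) (p : formula) : Prop :=
  match p with
  | Feq t u => tmax t <= s /\ tmax u <= s
  | Fprf z q => tmax z <= s /\ tbnd s q
  | Fbot => True
  | Fand p q | For p q | Fimp p q => tbnd s p /\ tbnd s q
  | Fall v p | Fex v p => vtype v <= s /\ tbnd s p
  end.

Definition lang (bound : option nat) (p : formula) : Prop :=
  wf p /\ match bound with None => True | Some s => tbnd s p end.

Fixpoint free (X : var) (p : formula) : Prop :=
  match p with
  | Feq t u => In X (tvars t) \/ In X (tvars u)
  | Fprf z q => In X (tvars z) \/ free X q
  | Fbot => False
  | Fand p q | For p q | Fimp p q => free X p \/ free X q
  | Fall v p | Fex v p => v <> X /\ free X p
  end.

Fixpoint fvs (p : formula) : list var :=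
  match p with
  | Feq t u => tvars t ++ tvars u
  | Fprf z q => tvars z ++ fvs q
  | Fbot => []
  | Fand p q | For p q | Fimp p q => fvs p ++ fvs q
  | Fall v p | Fex v p => remove var_eq_dec v (fvs p)
  end.

Definition sortf (p : formula) : nat := fold_right Nat.max 0 (map vtype (fvs p)).

Fixpoint subst (X : var) (r : term) (p : formula) : formula :=
  match p with
  | Feq t u => Feq (tsubst X r t) (tsubst X r u)
  | Fprf z q => Fprf (tsubst X r z) (subst X r q)
  | Fbot => Fbot
  | Fand p q => Fand (subst X r p) (subst X r q)
  | For p q => For (subst X r p) (subst X r q)
  | Fimp p q => Fimp (subst X r p) (subst X r q)
  | Fall v p => if var_eq_dec v X then Fall v p else Fall v (subst X r p)
  | Fex v p => if var_eq_dec v X then Fex v p else Fex v (subst X r p)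
  end.

Fixpoint free_for (r : term) (X : var) (p : formula) : Prop :=
  match p with
  | Feq _ _ | Fbot => True
  | Fprf _ q => free_for r X q
  | Fand p q | For p q | Fimp p q => free_for r X p /\ free_for r X q
  | Fall v q | Fex v q =>
      ~ free X p \/ (~ In v (tvars r) /\ free_for r X q)
  end.

Definition inst_ok (X : var) (r : term) : Prop :=
  match X with
  | vnum _ => tyof r = Some 0
  | vfun KF n _ => 1 <= n /\ tyof r = Some n
  | vfun k n _ => 1 <= n /\ exists j, r = tvar (vfun k n j)
  end.

Inductive LogAx : formula -> Prop :=
| LA1 p q : LogAx (Fimp p (Fimp q p))
| LA2 p q r : LogAx (Fimp (Fimp p (Fimp q r)) (Fimp (Fimp p q) (Fimp p r)))
| LA3 p q : LogAx (Fimp (Fand p q) p)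
| LA4 p q : LogAx (Fimp (Fand p q) q)
| LA5 p q : LogAx (Fimp p (Fimp q (Fand p q)))
| LA6 p q : LogAx (Fimp p (For p q))
| LA7 p q : LogAx (Fimp q (For p q))
| LA8 p q r : LogAx (Fimp (Fimp p r) (Fimp (Fimp q r) (Fimp (For p q) r)))
| LA9 p : LogAx (Fimp Fbot p)
| LAall X r p : inst_ok X r -> free_for r X p -> LogAx (Fimp (Fall X p) (subst X r p))
| LAex X r p : inst_ok X r -> free_for r X p -> LogAx (Fimp (subst X r p) (Fex X p))
| LArefl t : LogAx (Feq t t)
| LAleib X t u p :
    (match X with vnum _ => True | vfun KF _ _ => True | _ => False end) ->
    tyof t = Some (vtype X) -> tyof u = Some (vtype X) ->
    free_for t X p -> free_for u X p ->
    LogAx (Fimp (Feq t u) (Fimp (subst X t p) (subst X u p))).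

Inductive Prov (Ax lg : formula -> Prop) : formula -> Prop :=
| Pax p : Ax p -> lg p -> Prov Ax lg p
| Plog p : LogAx p -> lg p -> Prov Ax lg p
| Pmp p q : Prov Ax lg p -> Prov Ax lg (Fimp p q) -> Prov Ax lg q
| Pgen p q X : Prov Ax lg (Fimp p q) -> ~ free X p ->
    lg (Fimp p (Fall X q)) -> Prov Ax lg (Fimp p (Fall X q))
| Pex p q X : Prov Ax lg (Fimp p q) -> ~ free X q ->
    lg (Fimp (Fex X p) q) -> Prov Ax lg (Fimp (Fex X p) q).

Definition vx (i : nat) : term := tvar (vnum i).
Definition Fv (k : fkind) (n i : nat) : term := tvar (vfun k n i).
Definition Kc (n : nat) : term := match n with 0 => tzero | S _ => tK n end.
Definition Nc (n : nat) (t : term) : term := match n with 0 => tS t | S _ => tN t end.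
Definition app0 (t : term) (k : nat) : term := Nat.iter k (fun u => tAp u tzero) t.

Inductive LPax : formula -> Prop :=
| Ax_S0 x : LPax (Fnot (Feq (tS (vx x)) tzero))
| Ax_Sinj x y : LPax (Fimp (Feq (tS (vx x)) (tS (vx y))) (Feq (vx x) (vx y)))
| Ax_add0 x : LPax (Feq (tplus (vx x) tzero) (vx x))
| Ax_addS x y : LPax (Feq (tplus (vx x) (tS (vx y))) (tS (tplus (vx x) (vx y))))
| Ax_mul0 x : LPax (Feq (tmult (vx x) tzero) tzero)
| Ax_mulS x y : LPax (Feq (tmult (vx x) (tS (vx y))) (tplus (tmult (vx x) (vx y)) (vx x)))
| Ax_ind x p : LPax (Fimp (Fand (subst (vnum x) tzero p)
                                (Fall (vnum x) (Fimp p (subst (vnum x) (tS (vx x)) p))))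
                          (Fall (vnum x) p))
| Ax_K n x : LPax (Feq (tAp (tK (S n)) (vx x)) (Kc n))
| Ax_NK n f : 1 <= n -> LPax (Fnot (Feq (tN (Fv KF n f)) (tK n)))
| Ax_NAp n f x : LPax (Feq (tAp (tN (Fv KF (S n) f)) (vx x)) (Nc n (tAp (Fv KF (S n) f) (vx x))))
| Ax_Ninj n f g : 1 <= n ->
    LPax (Fimp (Feq (tN (Fv KF n f)) (tN (Fv KF n g))) (Feq (Fv KF n f) (Fv KF n g)))
| Ax_lawlike a x t :
    (forall v, In v (tvars t) -> (exists i, v = vnum i) \/ (exists i, v = vfun KA 1 i)) ->
    ~ In (vfun KA 1 a) (tvars t) -> tyof t = Some 0 ->
    LPax (Fex (vfun KA 1 a) (Fall (vnum x) (Feq (tAp (Fv KA 1 a) (vx x)) t)))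
| Ax_CS1 z p : isL p -> LPax (For (Fprf (vx z) p) (Fnot (Fprf (vx z) p)))
| Ax_CS2 z y p : isL p -> LPax (Fimp (Fprf (vx z) p) (Fprf (tplus (vx z) (vx y)) p))
| Ax_CS3 z p : isL p -> ~ free (vnum z) p -> LPax (Fiff (Fex (vnum z) (Fprf (vx z) p)) p).

Definition ExU (n g g' : nat) (p : formula) : formula :=
  Fex (vfun KF n g) (Fand p (Fall (vfun KF n g')
        (Fimp (subst (vfun KF n g) (Fv KF n g') p) (Feq (Fv KF n g') (Fv KF n g))))).

Inductive Cax : formula -> Prop :=
| C1 p x y f m :
    x <> y -> ~ free (vfun KF m f) p -> Nat.max (sortf p) 1 <= m ->
    free_for (app0 (tAp (Fv KF m f) (vx x)) (m - 1)) (vnum y) p ->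
    Cax (Fimp (Fall (vnum x) (Fex (vnum y) p))
              (Fex (vfun KF m f) (Fall (vnum x)
                 (subst (vnum y) (app0 (tAp (Fv KF m f) (vx x)) (m - 1)) p))))
| C2 p x n g g' f m :
    1 <= n -> Nat.max (sortf p) (n + 1) <= m -> ~ free (vfun KF m f) p ->
    g' <> g -> ~ free (vfun KF n g') p -> free_for (Fv KF n g') (vfun KF n g) p ->
    free_for (app0 (tAp (Fv KF m f) (vx x)) (m - n - 1)) (vfun KF n g) p ->
    Cax (Fimp (Fall (vnum x) (ExU n g g' p))
              (Fex (vfun KF m f) (Fall (vnum x)
                 (subst (vfun KF n g) (app0 (tAp (Fv KF m f) (vx x)) (m - n - 1)) p)))).

Definition KSinst (psi : formula) : Prop :=
  exists p m g x,
    isL p /\ ~ free (vfun KF m g) p /\ Nat.max (sortf p) 1 <= m /\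
    psi = Fex (vfun KF m g)
            (Fiff p (Fex (vnum x)
               (Fnot (Feq (app0 (tAp (Fv KF m g) (vx x)) (m - 1)) tzero)))).

Definition LPC (p : formula) : Prop := LPax p \/ Cax p.

Definition ext {C : Type} (x y : list C) : Prop := exists z, x = y ++ z.

Definition chain {C : Type} (P : list C -> Prop) : Prop :=
  forall x y, P x -> P y -> ext x y \/ ext y x.
Definition bpath {C : Type} (P : list C -> Prop) : Prop :=
  chain P /\ forall Q, chain Q -> (forall x, P x -> Q x) -> forall x, Q x -> P x.

Definition monoF {C X : Type} (f : list C -> nat -> option X) : Prop :=
  forall x y, ext y x -> forall n v, f x n = Some v -> f y n = Some v.
Definition completeF {C X : Type} (f : list C -> nat -> option X) : Prop :=
  forall P, bpath P -> forall n, exists x, P x /\ exists v, f x n = Some v.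
Definition good {C X : Type} (f : list C -> nat -> option X) : Prop :=
  monoF f /\ completeF f.

(* lev k = (a_k, Col k), Col k = a_0 * ... * a_k; an element of d_k
   (a tuple of sequences of common length m) is a list of m columns *)
Fixpoint lev (k : nat) : Type * Type :=
  match k with
  | 0 => (@pair Type Type nat nat)
  | S k' =>
      let Ak1 := {f : list (snd (lev k')) -> nat -> option (fst (lev k')) | good f} in
      (Ak1, (snd (lev k') * Ak1)%type)
  end.

Definition A (k : nat) : Type := fst (lev k).
Definition Col (k : nat) : Type := snd (lev k).
Definition Val : Type := {k : nat & A k}.

Lemma path_nil {C : Type} (P : list C -> Prop) : bpath P -> P [].
Proof.
  intros [Hc Hm]. apply (Hm (fun x => P x \/ x = [])).
  - intros x y [Hx|Hx] [Hy|Hy].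
    + apply Hc; assumption.
    + subst y. left. exists x. reflexivity.
    + subst x. right. exists y. reflexivity.
    + subst. left. exists []. reflexivity.
  - intros x Hx. left. exact Hx.
  - right. reflexivity.
Qed.

Lemma good_const {C X : Type} (v : X) : good (fun (_ : list C) (_ : nat) => Some v).
Proof.
  split.
  - intros x y _ n w H. exact H.
  - intros P HP n. exists []. split; [apply path_nil; exact HP | eauto].
Qed.

Lemma good_map {C X Y : Type} (g : X -> Y) (f : list C -> nat -> option X) :
  good f -> good (fun x n => option_map g (f x n)).
Proof.
  intros [Hm Hc]. split.
  - intros x y Hxy n w H. destruct (f x n) eqn:E; [|discriminate].
    simpl in H. rewrite (Hm _ _ Hxy _ _ E). exact H.
  - intros P HP n. destruct (Hc P HP n) as [x [Px [v Hv]]].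
    exists x. split; [exact Px|]. rewrite Hv. exists (g v). reflexivity.
Qed.

Fixpoint Khat (k : nat) : A (S k) :=
  match k return A (S k) with
  | 0 => exist (@good (Col 0) (A 0)) (fun _ _ => Some 0) (good_const 0)
  | S k' => exist (@good (Col (S k')) (A (S k'))) (fun _ _ => Some (Khat k')) (good_const _)
  end.

Fixpoint Shat (k : nat) : A k -> A k :=
  match k return A k -> A k with
  | 0 => S
  | S k' => fun f => exist (@good (Col k') (A k'))
                           (fun x n => option_map (Shat k') (proj1_sig f x n))
                           (good_map (Shat k') _ (proj2_sig f))
  end.

Fixpoint trunc (j i : nat) : Col j -> option (Col i) :=
  match j return Col j -> option (Col i) with
  | 0 => fun c => match Nat.eq_dec 0 i with
                  | left e => Some (eq_rect 0 Col c i e)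
                  | right _ => None end
  | S j' => fun c => match Nat.eq_dec (S j') i with
                     | left e => Some (eq_rect (S j') Col c i e)
                     | right _ => trunc j' i (fst c) end
  end.

Fixpoint truncs (j i : nat) (xs : list (Col j)) : option (list (Col i)) :=
  match xs with
  | [] => Some []
  | c :: r => match trunc j i c, truncs j i r with
              | Some c', Some r' => Some (c' :: r')
              | _, _ => None end
  end.

Definition lastc (k : nat) : Col k -> A k :=
  match k return Col k -> A k with
  | 0 => fun c => c
  | S k' => fun c => snd c
  end.

Definition asnat (d : Val) : option nat :=
  match d with
  | existT _ k x => match k return A k -> option nat with
                    | 0 => fun x => Some x
                    | S _ => fun _ => None end x
  end.

(* nodes of B_s: elements of d_{s-1}; the root is [] *)
Definition Node (s : nat) : Type := list (Col (s - 1)).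

(* value of a term at node a (None = undefined);
   Ap^k(f,n) at a is f(\bar a(k), n) *)
Fixpoint eval (s : nat) (rho : var -> Val) (a : Node s) (t : term) : option Val :=
  match t with
  | tvar v => Some (rho v)
  | tzero => Some (existT A 0 0)
  | tK n => match n with 0 => None | S k => Some (existT A (S k) (Khat k)) end
  | tS u => match option_map asnat (eval s rho a u) with
            | Some (Some m) => Some (existT A 0 (S m)) | _ => None end
  | tplus u w => match option_map asnat (eval s rho a u), option_map asnat (eval s rho a w) with
                 | Some (Some m), Some (Some m') => Some (existT A 0 (m + m')) | _, _ => None end
  | tmult u w => match option_map asnat (eval s rho a u), option_map asnat (eval s rho a w) with
                 | Some (Some m), Some (Some m') => Some (existT A 0 (m * m')) | _, _ => None end
  | tN u => match eval s rho a u with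
            | Some (existT _ k x) => Some (existT A k (Shat k x)) | None => None end
  | tAp f u =>
      match eval s rho a f, option_map asnat (eval s rho a u) with
      | Some (existT _ k g), Some (Some m) =>
          match k return A k -> option Val with
          | 0 => fun _ => None
          | S k' => fun g =>
              match truncs (s - 1) k' a with
              | Some a' => option_map (existT A k') (proj1_sig g a' m)
              | None => None end
          end g
      | _, _ => None
      end
  end.

Definition bij {X : Type} (h : X -> X) : Prop :=
  exists g, (forall x, g (h x) = x) /\ (forall y, h (g y) = y).

Definition lawlikeP (d : Val) : Prop :=
  match d with
  | existT _ k f => match k return A k -> Prop with
                    | 0 => fun _ => False
                    | S k' => fun f => forall m, exists v, proj1_sig f [] m = Some v
                    end f
  end.

Definition lawlessP (d : Val) : Prop :=
  match d with
  | existT _ k f => match k return A k -> Prop with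
                    | 0 => fun _ => False
                    | S k' => fun f =>
                        exists xi : nat -> A k' -> A k',
                          (forall m, bij (xi m)) /\
                          forall x m, proj1_sig f x m =
                            match nth_error x m with
                            | Some c => Some (xi m (lastc k' c))
                            | None => None end
                    end f
  end.

Definition dom (v : var) (d : Val) : Prop :=
  match v with
  | vnum _ => projT1 d = 0
  | vfun k n _ => projT1 d = n /\ 1 <= n /\
      match k with KF => True | KA => lawlikeP d | KL => lawlessP d end
  end.

Definition env_ok (rho : var -> Val) : Prop := forall v, var_ok v -> dom v (rho v).

Definition upd (rho : var -> Val) (v : var) (d : Val) : var -> Val :=
  fun w => if var_eq_dec w v then d else rho w.

Definition bar {s : nat} (a : Node s) (R : Node s -> Prop) : Prop :=
  forall P : Node s -> Prop, bpath P -> P a -> exists b, P b /\ ext b a /\ R b.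

Fixpoint forces (s : nat) (p : formula) (rho : var -> Val) (a : Node s) {struct p} : Prop :=
  match p with
  | Feq t u => bar a (fun b => exists d, eval s rho b t = Some d /\ eval s rho b u = Some d)
  | Fprf z q => bar a (fun b => exists m, eval s rho b z = Some (existT A 0 m) /\
                          exists g : Node s, ext b g /\ length g = m /\ forces s q rho g)
  | Fbot => False
  | Fand p q => forces s p rho a /\ forces s q rho a
  | For p q => bar a (fun b => forces s p rho b \/ forces s q rho b)
  | Fimp p q => forall b : Node s, ext b a -> forces s p rho b -> forces s q rho b
  | Fall v q => forall d, dom v d -> forces s q (upd rho v d) a
  | Fex v q => bar a (fun b => exists d, dom v d /\ forces s q (upd rho v d) b)
  end.

(* Main.v *)
From Stdlib Require Import ClassicalEpsilon ProofIrrelevance FunctionalExtensionality.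
From Stdlib Require Import List Arith PeanoNat Lia Eqdep_dec.
Require Import Defs.
Import ListNotations.

(** In the theory, [|-_z p] is decidable (CS1), so choice (C1) applied to
    "[y = 1] and [|-_z p], or [y = 0] and not [|-_z p]" gives its characteristic functional [G],
    and [p] is equivalent to [exists z, |-_z p] (CS3).

    In the model the same [G] works: [G(x)(n)] is [1] or [0] according to whether the initial
    segment of length [n] of the current node forces [p].  But [G] has type [m], so it only sees
    the first [m] components of a node of [B_s], whereas [p] may quantify over all types up to
    [s].  One thus needs that the forcing of [p], whose parameters have type at most [m], depends
    only on these components.  If two nodes of equal length agree on them, the involution of the
    tree that swaps their entries position by position in the higher components carries one to the
    other; it acts on all the domains [a_k], [b_k], [l_k], commutes with the operations, and fixes
    every object of type at most [m]. *)

(** * Substitution, free variables and sorts *)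

Lemma tsubst_fresh X r t : ~ In X (tvars t) -> tsubst X r t = t.
Proof.
  induction t; simpl; intros H; auto;
    try (rewrite in_app_iff in H; rewrite IHt1, IHt2 by tauto; reflexivity);
    try (rewrite IHt by tauto; reflexivity).
  destruct (var_eq_dec v X); [subst; tauto | reflexivity].
Qed.

Lemma subst_fresh X r p : ~ free X p -> subst X r p = p.
Proof.
  induction p; simpl; intros H; auto;
    try (rewrite IHp1, IHp2 by tauto; reflexivity).
  - rewrite !tsubst_fresh by tauto; reflexivity.
  - rewrite tsubst_fresh, IHp by tauto; reflexivity.
  - destruct (var_eq_dec v X); [reflexivity | rewrite IHp by tauto; reflexivity].
  - destruct (var_eq_dec v X); [reflexivity | rewrite IHp by tauto; reflexivity].
Qed.

Lemma free_for_fresh r X p : ~ free X p -> free_for r X p.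
Proof. induction p; simpl; tauto. Qed.

Lemma tsubst_id X t : tsubst X (tvar X) t = t.
Proof.
  induction t; simpl; try congruence.
  destruct (var_eq_dec v X); congruence.
Qed.

Lemma subst_id X p : subst X (tvar X) p = p.
Proof.
  induction p; simpl; rewrite ?tsubst_id; try congruence;
    destruct (var_eq_dec v X); congruence.
Qed.

Lemma free_for_id X p : free_for (tvar X) X p.
Proof.
  induction p; simpl; auto;
    (destruct (var_eq_dec v X); [left; tauto | right; intuition congruence]).
Qed.

Lemma free_fvs X p : free X p <-> In X (fvs p).
Proof.
  induction p; simpl; rewrite ?in_app_iff; try tauto.
  - split.
    + intros [H1 H2]. apply in_in_remove; [congruence | tauto].
    + intros H. apply in_remove in H. intuition congruence.
  - split.
    + intros [H1 H2]. apply in_in_remove; [congruence | tauto].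
    + intros H. apply in_remove in H. intuition congruence.
Qed.

Lemma sortf_le p m : sortf p <= m <-> forall v, free v p -> vtype v <= m.
Proof.
  unfold sortf. transitivity (forall v, In v (fvs p) -> vtype v <= m).
  - induction (fvs p) as [|w l IH]; simpl.
    + split; [intros _ v [] | lia].
    + split.
      * intros H v [<-|Hv]; [lia | apply IH; [lia | exact Hv]].
      * intros H. apply Nat.max_lub; [apply H; auto | apply IH; auto].
  - split; intros H v Hv; apply H, free_fvs, Hv.
Qed.

(** A bound rather than a single variable, because two fresh number variables are needed at once:
    the stage of [Fprf] and the value of its characteristic function. *)
Lemma exists_fresh_num l : exists z, forall j, z <= j -> ~ In (vnum j) l.
Proof.
  induction l as [|v l [z IH]].
  - exists 0. intros j _ [].
  - exists (match v with vnum i => Nat.max z (S i) | _ => z end).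
    intros j Hj [E|E].
    + subst v. lia.
    + apply (IH j); [destruct v; lia | exact E].
Qed.

Lemma tsubst_app0 X r t k : tsubst X r (app0 t k) = app0 (tsubst X r t) k.
Proof. induction k; simpl; [reflexivity | rewrite IHk; reflexivity]. Qed.

Lemma tvars_app0 t k : tvars (app0 t k) = tvars t.
Proof. induction k; simpl; [reflexivity | rewrite IHk, app_nil_r; reflexivity]. Qed.

Lemma tmax_app0 t k : tmax (app0 t k) = tmax t.
Proof. induction k; simpl; [reflexivity | rewrite IHk; lia]. Qed.

Lemma tyof_app0 t k n : tyof t = Some (k + n) -> tyof (app0 t k) = Some n.
Proof.
  revert t n. induction k; intros t n H; [exact H|].
  simpl. rewrite (IHk t (S n)); [reflexivity | rewrite H; f_equal; lia].
Qed.

(** * The formal derivation *)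

(** The type restriction that [lang] puts on quantified variables. Keeping the bound optional lets a
    single derivation serve both $LP_s$ and $LP$. *)
Definition tle (bound : option nat) (k : nat) : Prop :=
  match bound with None => True | Some s => k <= s end.

Lemma lang_and b p q : lang b (Fand p q) <-> lang b p /\ lang b q.
Proof. unfold lang; destruct b; simpl; tauto. Qed.
Lemma lang_or b p q : lang b (For p q) <-> lang b p /\ lang b q.
Proof. unfold lang; destruct b; simpl; tauto. Qed.
Lemma lang_imp b p q : lang b (Fimp p q) <-> lang b p /\ lang b q.
Proof. unfold lang; destruct b; simpl; tauto. Qed.
Lemma lang_bot b : lang b Fbot.
Proof. unfold lang; destruct b; simpl; tauto. Qed.
Lemma lang_not b p : lang b (Fnot p) <-> lang b p.
Proof. unfold lang; destruct b; simpl; tauto. Qed.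
Lemma lang_all b v p : lang b (Fall v p) <-> (var_ok v /\ tle b (vtype v)) /\ lang b p.
Proof. unfold lang, tle; destruct b; simpl; tauto. Qed.
Lemma lang_ex b v p : lang b (Fex v p) <-> (var_ok v /\ tle b (vtype v)) /\ lang b p.
Proof. unfold lang, tle; destruct b; simpl; tauto. Qed.
Lemma lang_prf b z p : isL p -> lang b (Fprf (vx z) p) <-> lang b p.
Proof. intros H. unfold lang; destruct b; simpl; intuition lia. Qed.
Lemma lang_eq0 b t u : tyof t = Some 0 -> tyof u = Some 0 ->
  tle b (tmax t) -> tle b (tmax u) -> lang b (Feq t u).
Proof. intros. unfold lang, tle in *; destruct b; simpl; eauto. Qed.

Local Ltac conj_split := repeat match goal with |- _ /\ _ => split end.

Section Hilbert.

Variables (Ax : formula -> Prop) (b : option nat).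
Local Notation Pr := (Prov Ax (lang b)).

(** Supplies the language side conditions of the axioms used below. Only modus ponens calls for an
    argument: its conclusion is a part of the implication proved before. *)
Lemma Prov_lang p : Pr p -> lang b p.
Proof.
  induction 1; auto. apply lang_imp in IHProv2. tauto.
Qed.

Lemma Prov_const h p : lang b h -> Pr p -> Pr (Fimp h p).
Proof.
  intros Hh Hp. apply (Pmp _ _ _ _ Hp), Plog; [constructor|].
  pose proof (Prov_lang _ Hp). rewrite !lang_imp. tauto.
Qed.

(** Together with [Prov_const] this replaces a deduction theorem: all reasoning is done on
    implications from one formula [h], which is also the shape that [Pgen] and [Pex] demand. *)
Lemma Prov_app h p q : Pr (Fimp h (Fimp p q)) -> Pr (Fimp h p) -> Pr (Fimp h q).
Proof.
  intros H1 H2. apply (Pmp _ _ _ _ H2), (Pmp _ _ _ _ H1), Plog; [constructor|].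
  pose proof (Prov_lang _ H1) as L. rewrite !lang_imp in *. tauto.
Qed.

Lemma Prov_id p : lang b p -> Pr (Fimp p p).
Proof.
  intros Hp. apply Prov_app with (p := Fimp p p); (apply Plog; [apply LA1|]);
    rewrite !lang_imp; tauto.
Qed.

Lemma Prov_trans p q r : Pr (Fimp p q) -> Pr (Fimp q r) -> Pr (Fimp p r).
Proof.
  intros H1 H2. apply Prov_app with (p := q); [|exact H1].
  apply Prov_const; [|exact H2]. apply Prov_lang, lang_imp in H1. tauto.
Qed.

Lemma Prov_andl h p q : Pr (Fimp h (Fand p q)) -> Pr (Fimp h p).
Proof.
  intros H. apply (Prov_trans _ _ _ H), Plog; [constructor|].
  apply Prov_lang in H. rewrite !lang_imp, !lang_and in *. tauto.
Qed.

Lemma Prov_andr h p q : Pr (Fimp h (Fand p q)) -> Pr (Fimp h q).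
Proof.
  intros H. apply (Prov_trans _ _ _ H), Plog; [constructor|].
  apply Prov_lang in H. rewrite !lang_imp, !lang_and in *. tauto.
Qed.

Lemma Prov_andI h p q : Pr (Fimp h p) -> Pr (Fimp h q) -> Pr (Fimp h (Fand p q)).
Proof.
  intros Hp Hq. apply Prov_app with (p := q); [|exact Hq].
  apply (Prov_trans _ _ _ Hp), Plog; [constructor|].
  apply Prov_lang in Hp, Hq. rewrite !lang_imp, !lang_and in *. tauto.
Qed.

Lemma Prov_curry h p q : Pr (Fimp (Fand h p) q) -> Pr (Fimp h (Fimp p q)).
Proof.
  intros H. pose proof (Prov_lang _ H) as L. rewrite lang_imp, lang_and in L.
  apply Prov_trans with (q := Fimp p (Fand h p)).
  - apply Plog; [constructor|]. rewrite !lang_imp, !lang_and. tauto.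
  - apply (Pmp _ _ (Fimp p (Fimp (Fand h p) q))).
    + apply Prov_const; tauto.
    + apply Plog; [constructor|]. rewrite !lang_imp, !lang_and. tauto.
Qed.

Lemma Prov_uncurry h p q : Pr (Fimp h (Fimp p q)) -> Pr (Fimp (Fand h p) q).
Proof.
  intros H. pose proof (Prov_lang _ H) as L. rewrite !lang_imp in L.
  assert (I : Pr (Fimp (Fand h p) (Fand h p))) by (apply Prov_id, lang_and; tauto).
  apply Prov_app with (p := p); [|exact (Prov_andr _ _ _ I)].
  exact (Prov_trans _ _ _ (Prov_andl _ _ _ I) H).
Qed.

Lemma Prov_swap h p q : Pr (Fimp h (Fimp p q)) -> Pr (Fimp p (Fimp h q)).
Proof.
  intros H. pose proof (Prov_lang _ H) as L. rewrite !lang_imp in L.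
  assert (I : Pr (Fimp (Fand p h) (Fand p h))) by (apply Prov_id, lang_and; tauto).
  apply Prov_curry, Prov_app with (p := p); [|exact (Prov_andl _ _ _ I)].
  exact (Prov_trans _ _ _ (Prov_andr _ _ _ I) H).
Qed.

Lemma Prov_orE p q r : Pr (Fimp p r) -> Pr (Fimp q r) -> Pr (Fimp (For p q) r).
Proof.
  intros Hp Hq. apply (Pmp _ _ _ _ Hq), (Pmp _ _ _ _ Hp), Plog; [constructor|].
  apply Prov_lang in Hp, Hq. rewrite !lang_imp, ?lang_or in *. tauto.
Qed.

Lemma Prov_orIl h p q : lang b q -> Pr (Fimp h p) -> Pr (Fimp h (For p q)).
Proof.
  intros Lq H. apply (Prov_trans _ _ _ H), Plog; [constructor|].
  apply Prov_lang in H. rewrite !lang_imp, ?lang_or in *. tauto.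
Qed.

Lemma Prov_orIr h p q : lang b p -> Pr (Fimp h q) -> Pr (Fimp h (For p q)).
Proof.
  intros Lp H. apply (Prov_trans _ _ _ H), Plog; [constructor|].
  apply Prov_lang in H. rewrite !lang_imp, ?lang_or in *. tauto.
Qed.

Lemma Prov_absurd h p q : lang b q -> Pr (Fimp h p) -> Pr (Fimp h (Fnot p)) -> Pr (Fimp h q).
Proof.
  intros Lq Hp Hn. apply (Prov_trans _ _ _ (Prov_app _ _ _ Hn Hp)), Plog; [constructor|].
  apply lang_imp; split; [apply lang_bot | exact Lq].
Qed.

(** [Pgen] generalizes only the consequent of an implication, so [p] is first put under the closed
    theorem [Fimp Fbot Fbot], which is then discharged. *)
Lemma Prov_gen X p : var_ok X -> tle b (vtype X) -> Pr p -> Pr (Fall X p).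
Proof.
  intros V1 V2 H. pose proof (Prov_lang _ H) as L.
  assert (B : Pr (Fimp Fbot Fbot)) by apply Prov_id, lang_bot.
  apply (Pmp _ _ _ _ B), Pgen; [apply Prov_const; [apply (Prov_lang _ B) | exact H] | simpl; tauto |].
  rewrite !lang_imp, lang_all. pose proof (lang_bot b). tauto.
Qed.

Lemma Prov_exI X r p : inst_ok X r -> free_for r X p -> var_ok X -> tle b (vtype X) ->
  lang b p -> lang b (subst X r p) -> Pr (Fimp (subst X r p) (Fex X p)).
Proof. intros. apply Plog; [constructor; assumption | rewrite lang_imp, lang_ex; tauto]. Qed.

End Hilbert.

(** Leibniz's law for the formula $v=0$ turns $t=1$ and $t=0$ into $1=0$, which contradicts the
    successor axiom. *)
Lemma Prov_num_neq (b : option nat) t : tyof t = Some 0 -> tle b (tmax t) ->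
  Prov LPC (lang b) (Fimp (Feq t (tS tzero)) (Fnot (Feq t tzero))).
Proof.
  intros Ty Tm. assert (T0 : tle b 0) by (destruct b; simpl; auto with arith).
  assert (L0 : forall u, tyof u = Some 0 -> tle b (tmax u) -> lang b (Feq u tzero))
    by (intros; apply lang_eq0; auto).
  assert (L1 : lang b (Feq t (tS tzero))) by (apply lang_eq0; auto).
  assert (N : Prov LPC (lang b) (Fnot (Feq (tS tzero) tzero))).
  { apply (Pmp _ _ (Fall (vnum 0) (Fnot (Feq (tS (vx 0)) tzero)))).
    - apply Prov_gen; [exact I | exact T0 |].
      apply Pax; [left; constructor | apply lang_not, L0; auto].
    - apply Plog.
      + exact (LAall (vnum 0) tzero (Fnot (Feq (tS (vx 0)) tzero)) eq_refl (conj I I)).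
      + rewrite lang_imp, lang_all, !lang_not. conj_split; try apply L0; simpl; auto. }
  apply Prov_curry, Prov_app with (p := Feq (tS tzero) tzero).
  - apply Prov_const; [apply lang_and; split; auto | exact N].
  - apply Prov_uncurry, Plog.
    + exact (LAleib (vnum 0) t (tS tzero) (Feq (vx 0) tzero) I Ty eq_refl I I).
    + rewrite !lang_imp. conj_split; auto; apply L0; auto.
Qed.

Lemma KS_derivable (b : option nat) psi : KSinst psi -> lang b psi -> Prov LPC (lang b) psi.
Proof.
  intros (p & m & g & x & Lp & Gp & Hm & ->) Lpsi.
  set (T := fun i => app0 (tAp (Fv KF m g) (vx i)) (m - 1)).
  fold (T x) in *.
  rewrite lang_ex in Lpsi. destruct Lpsi as [[_ Bm] Lpsi].
  unfold Fiff in Lpsi. rewrite lang_and, !lang_imp in Lpsi. destruct Lpsi as [[lp lE] _].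
  simpl in Bm.
  assert (T0 : tle b 0) by (destruct b; simpl; auto with arith).
  assert (TyT : forall i, tyof (T i) = Some 0).
  { intros i. apply tyof_app0. simpl. destruct m; [lia|]. simpl. f_equal. lia. }
  assert (BT : forall i, tle b (tmax (T i))).
  { intros i. unfold T. rewrite tmax_app0. simpl. rewrite Nat.max_0_r. exact Bm. }
  assert (FT : forall i v, In v (tvars (T i)) <-> v = vfun KF m g \/ v = vnum i).
  { intros i v. unfold T. rewrite tvars_app0. simpl. intuition congruence. }
  assert (ST : forall i j, tsubst (vnum i) (vx j) (T i) = T j).
  { intros i j. unfold T. rewrite tsubst_app0. simpl.
    destruct (Nat.eq_dec i i); [reflexivity | congruence]. }
  destruct (exists_fresh_num (fvs p)) as [z Hz].
  assert (Fz : ~ free (vnum z) p) by (rewrite free_fvs; apply Hz; lia).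
  assert (Fy : ~ free (vnum (S z)) p) by (rewrite free_fvs; apply Hz; lia).
  set (P := Fprf (vx z) p).
  (* The graph of the characteristic function of [P], as a predicate of the value [t]. The stage [z]
     and the value variable [S z] are both fresh for [p]. *)
  set (chi := fun t => For (Fand P (Feq t (tS tzero))) (Fand (Fnot P) (Feq t tzero))).
  assert (lP : lang b P) by (apply lang_prf; assumption).
  assert (lchi : forall t, tyof t = Some 0 -> tle b (tmax t) -> lang b (chi t)).
  { intros t H1 H2. unfold chi. rewrite lang_or, !lang_and, lang_not.
    conj_split; auto; apply lang_eq0; auto. }
  assert (Schi : forall r, subst (vnum (S z)) r (chi (vx (S z))) = chi r).
  { intros r. unfold chi. simpl. rewrite subst_fresh by exact Fy.
    destruct (Nat.eq_dec z (S z)); [lia|].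
    destruct (Nat.eq_dec z z); [reflexivity | congruence]. }
  assert (Fchi : forall r, free_for r (vnum (S z)) (chi (vx (S z)))).
  { intros r. simpl. pose proof (free_for_fresh r _ _ Fy). tauto. }
  assert (H1 : Prov LPC (lang b) (Fall (vnum z) (Fex (vnum (S z)) (chi (vx (S z)))))).
  { apply Prov_gen; [exact I | exact T0 |].
    assert (Inst : forall t, tyof t = Some 0 -> tle b (tmax t) ->
       Prov LPC (lang b) (Fimp (chi t) (Fex (vnum (S z)) (chi (vx (S z)))))).
    { intros t Ht Bt. rewrite <- (Schi t). apply Prov_exI;
        [exact Ht | apply Fchi | exact I | exact T0 | apply lchi; auto | rewrite Schi; auto]. }
    assert (R : forall t, tyof t = Some 0 -> tle b (tmax t) -> Prov LPC (lang b) (Feq t t)).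
    { intros t Ht Bt. apply Plog; [constructor | apply lang_eq0; auto]. }
    apply (Pmp _ _ (For P (Fnot P))).
    - apply Pax; [left; constructor; assumption | rewrite lang_or, lang_not; auto].
    - apply Prov_orE.
      + apply Prov_trans with (q := chi (tS tzero)); [|apply Inst; auto].
        apply Prov_orIl; [rewrite lang_and, lang_not; split; [|apply lang_eq0]; auto |].
        apply Prov_andI; [apply Prov_id | apply Prov_const; [|apply R]]; auto.
      + apply Prov_trans with (q := chi tzero); [|apply Inst; auto].
        apply Prov_orIr; [rewrite lang_and; split; [|apply lang_eq0]; auto |].
        apply Prov_andI; [apply Prov_id | apply Prov_const; [|apply R]]; rewrite ?lang_not; auto. }
  set (H := Fall (vnum z) (chi (T z))).
  set (E := fun i => Fex (vnum i) (Fnot (Feq (T i) tzero))).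
  assert (lT : forall i, lang b (Feq (T i) tzero)) by (intros; apply lang_eq0; auto).
  assert (lH : lang b H) by (apply lang_all; simpl; auto).
  assert (lEi : forall i, lang b (E i)) by (intros; apply lang_ex; rewrite lang_not; simpl; auto).
  assert (lG : forall q, lang b q -> lang b (Fex (vfun KF m g) q)).
  { intros q Hq. apply lang_ex. simpl. conj_split; auto; lia. }
  assert (H2 : Prov LPC (lang b) (Fex (vfun KF m g) H)).
  { apply (Pmp _ _ _ _ H1). unfold H. rewrite <- (Schi (T z)). apply Pax.
    - right. apply C1; [lia | | | apply Fchi].
      + simpl. intuition congruence.
      (* Besides the free variables of [p], [chi] contains only number variables, so [m] still
         dominates its sort and (C1) yields a functional of type [m]. *)
      + apply Nat.max_lub; [|lia]. apply sortf_le. intros v Hv.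
        assert (Hv' : free v p \/ vtype v = 0) by
          (simpl in Hv; intuition (subst; auto)).
        destruct Hv' as [Hv'|Hv']; [|lia].
        apply (proj1 (sortf_le p m)); [lia | exact Hv'].
    - apply lang_imp. split; [apply (Prov_lang _ _ _ H1)|].
      rewrite Schi. apply lG, lH. }
  assert (H3 : Prov LPC (lang b) (Fimp H (chi (T z)))).
  { apply Plog; [|apply lang_imp; auto].
    rewrite <- (subst_id (vnum z) (chi (T z))).
    apply LAall; [reflexivity | apply free_for_id]. }
  (* The indices are independent so that the bound variable can be renamed: [x] comes with the
     schema and may occur free in [p], whereas [z] cannot. *)
  assert (H4 : forall i j, Prov LPC (lang b) (Fimp (Fnot (Feq (T j) tzero)) (E i))).
  { intros i j.
    assert (S1 : subst (vnum i) (vx j) (Fnot (Feq (T i) tzero)) = Fnot (Feq (T j) tzero))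
      by (simpl; rewrite ST; reflexivity).
    rewrite <- S1. apply Prov_exI;
      [reflexivity | simpl; auto | exact I | exact T0
      | apply lang_not, lT | rewrite S1; apply lang_not, lT]. }
  assert (H5 : Prov LPC (lang b) (Fiff (Fex (vnum z) P) p)).
  { apply Pax; [left; constructor; assumption |].
    unfold Fiff. rewrite lang_and, !lang_imp, lang_ex. simpl. tauto. }
  assert (H5i : Prov LPC (lang b) (Fimp (Fex (vnum z) P) p) /\
                Prov LPC (lang b) (Fimp p (Fex (vnum z) P))).
  { assert (K : lang b (Fimp (Fex (vnum z) P) p)) by (rewrite lang_imp, lang_ex; simpl; auto).
    assert (K' : lang b (Fimp p (Fex (vnum z) P))) by (rewrite lang_imp, lang_ex; simpl; auto).
    split; apply (Pmp _ _ _ _ H5), Plog; try (apply LA3 || apply LA4);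
      apply lang_imp; split; auto; apply lang_and; auto. }
  clear H5. destruct H5i as [H5 H5'].
  assert (FH : ~ free (vnum z) H) by (simpl; tauto).
  assert (FE : forall i j, ~ free (vnum i) (E j)).
  { intros i j. simpl. rewrite FT. intuition congruence. }
  (* By CS3, [p] yields a stage [z] with [P]. There the second disjunct of [chi (T z)] is absurd,
     and the first gives the value 1, which is not 0. *)
  assert (Fwd : Prov LPC (lang b) (Fimp H (Fimp p (E x)))).
  { apply Prov_swap, (Prov_trans _ _ _ _ _ H5').
    apply Pex; [| simpl; intros [K|K]; [exact (FH K) | exact (FE z x K)]
                | rewrite !lang_imp, lang_ex; simpl; auto].
    apply Prov_swap, (Prov_trans _ _ _ _ _ H3), Prov_orE; apply Prov_curry.
    - apply Prov_trans with (q := Fnot (Feq (T z) tzero)); [|apply H4].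
      apply Prov_trans with (q := Feq (T z) (tS tzero)); [|apply Prov_num_neq; auto].
      eapply Prov_andr, Prov_andl, Prov_id. rewrite !lang_and. conj_split; auto.
      apply lang_eq0; auto.
    - assert (K : lang b (Fand (Fand (Fnot P) (Feq (T z) tzero)) P))
        by (rewrite !lang_and, lang_not; auto).
      apply Prov_absurd with (p := P); auto.
      + eapply Prov_andr, Prov_id, K.
      + eapply Prov_andl, Prov_andl, Prov_id, K. }
  assert (Bwd : Prov LPC (lang b) (Fimp H (Fimp (E x) p))).
  { apply Prov_swap, Prov_trans with (q := E z).
    (* Renames [x] to [z]. At a stage with nonzero value the second disjunct of [chi (T z)] is
       absurd, so [P] holds there and CS3 returns [p]. *)
    { apply Pex; [apply H4 | apply FE | apply lang_imp; split; apply lEi]. }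
    apply Pex; [| simpl; intros [K|K]; [exact (FH K) | exact (Fz K)]
                | rewrite !lang_imp; conj_split; auto; apply lEi].
    apply Prov_swap, (Prov_trans _ _ _ _ _ H3), Prov_orE; apply Prov_curry.
    - apply Prov_trans with (q := P).
      + eapply Prov_andl, Prov_andl, Prov_id. rewrite !lang_and, lang_not. conj_split; auto.
        apply lang_eq0; auto.
      + apply Prov_trans with (q := Fex (vnum z) P); [|exact H5].
        rewrite <- (subst_id (vnum z) P) at 1.
        apply Prov_exI;
          [reflexivity | apply free_for_id | exact I | exact T0 | exact lP
          | rewrite subst_id; exact lP].
    - assert (K : lang b (Fand (Fand (Fnot P) (Feq (T z) tzero)) (Fnot (Feq (T z) tzero))))
        by (rewrite !lang_and, !lang_not; auto).
      apply Prov_absurd with (p := Feq (T z) tzero); auto.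
      + eapply Prov_andr, Prov_andl, Prov_id, K.
      + eapply Prov_andr, Prov_id, K. }
  pose proof (Prov_andI _ _ _ _ _ Fwd Bwd) as Both.
  change (Fand (Fimp p (E x)) (Fimp (E x) p)) with (Fiff p (E x)) in Both.
  assert (lB : lang b (Fiff p (E x))) by (apply Prov_lang, lang_imp in Both; tauto).
  apply (Pmp _ _ _ _ H2), Pex.
  - apply (Prov_trans _ _ _ _ _ Both).
    (* The functional obtained from (C1) is its own witness: the variable is instantiated by
       itself. *)
    rewrite <- (subst_id (vfun KF m g) (Fiff p (E x))) at 1.
    apply Prov_exI; auto using free_for_id.
    + simpl. destruct m; [lia|]. split; [lia | reflexivity].
    + simpl. lia.
    + rewrite subst_id. exact lB.
  - simpl. tauto.
  - apply lang_imp. split; apply lG; assumption.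
Qed.

(** * Paths *)

Lemma ext_refl {C : Type} (x : list C) : ext x x.
Proof. exists []. symmetry. apply app_nil_r. Qed.

Lemma ext_trans {C : Type} (x y z : list C) : ext x y -> ext y z -> ext x z.
Proof. intros [u ->] [v ->]. exists (v ++ u). symmetry. apply app_assoc. Qed.

Lemma ext_length {C : Type} (x y : list C) : ext x y -> length y <= length x.
Proof. intros [u ->]. rewrite length_app. lia. Qed.

Lemma ext_length_eq {C : Type} (x y : list C) : ext x y -> length x <= length y -> x = y.
Proof.
  intros [[|c u] ->] H; [apply app_nil_r|]. rewrite length_app in H. simpl in H. lia.
Qed.

Lemma ext_comparable {C : Type} (x y z : list C) : ext x y -> ext x z -> ext y z \/ ext z y.
Proof.
  intros [u ->] [v E]. destruct (app_eq_app _ _ _ _ E) as [l [[-> _]|[-> _]]];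
    [left | right]; exists l; reflexivity.
Qed.

Lemma ext_firstn {C : Type} (x : list C) n : ext x (firstn n x).
Proof. exists (skipn n x). symmetry. apply firstn_skipn. Qed.

Lemma firstn_ext {C : Type} (x y : list C) n :
  ext x y -> n <= length y -> firstn n x = firstn n y.
Proof.
  intros [u ->] H. rewrite firstn_app.
  replace (n - length y) with 0 by lia. apply app_nil_r.
Qed.

(** Adjoining to a maximal chain a node comparable with all its members leaves it a chain, so the
    node was already there. *)
Lemma path_add {C : Type} (P : list C -> Prop) (y : list C) :
  bpath P -> (forall w, P w -> ext w y \/ ext y w) -> P y.
Proof.
  intros [Hc Hm] H. apply (Hm (fun w => P w \/ w = y)); auto.
  intros u v [Hu| ->] [Hv| ->]; auto.
  - destruct (H _ Hv); auto.
  - left. apply ext_refl.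
Qed.

Lemma path_prefix {C : Type} (P : list C -> Prop) x y : bpath P -> P x -> ext x y -> P y.
Proof.
  intros HP Hx Hxy. apply path_add; [exact HP|]. intros w Hw.
  destruct (proj1 HP _ _ Hw Hx) as [K|K].
  - left. exact (ext_trans _ _ _ K Hxy).
  - apply (ext_comparable _ _ _ K Hxy).
Qed.

(** The column [c] makes the tree free of dead ends. A path that stopped at [x] could be lengthened
    by [x ++ [c]], against maximality; a longer node of the path is cut down to the wanted
    length. *)
Lemma path_length {C : Type} (P : list C -> Prop) (c : C) :
  bpath P -> forall n, exists x, P x /\ length x = n.
Proof.
  intros HP n. induction n as [|n [x [Hx Lx]]].
  - exists []. split; [apply path_nil, HP | reflexivity].
  - destruct (classic (exists w, P w /\ S n <= length w)) as [[w [Hw Lw]]|N].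
    + exists (firstn (S n) w). split.
      * apply (path_prefix _ _ _ HP Hw), ext_firstn.
      * rewrite length_firstn. lia.
    + exists (x ++ [c]). split; [|rewrite length_app; simpl; lia].
      apply path_add; [exact HP|]. intros w Hw. right.
      assert (K : ext x w).
      { assert (Lw : length w <= n) by
          (destruct (le_lt_dec (length w) n); [assumption | exfalso; eauto]).
        destruct (proj1 HP _ _ Hw Hx) as [K|K]; [|exact K].
        rewrite (ext_length_eq _ _ K) by lia. apply ext_refl. }
      apply (ext_trans _ x); [exists [c]; reflexivity | exact K].
Qed.

Lemma path_extend {C : Type} (P : list C -> Prop) (c : C) x n :
  bpath P -> P x -> exists y, P y /\ ext y x /\ n <= length y.
Proof.
  intros HP Hx. destruct (path_length P c HP (Nat.max n (length x))) as [y [Hy Ly]].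
  exists y. split; [exact Hy|]. split; [|lia].
  destruct (proj1 HP _ _ Hy Hx) as [K|K]; [exact K|].
  rewrite (ext_length_eq _ _ K) by lia. apply ext_refl.
Qed.

(** The path consists of the initial segments of [a] continued by [c] forever. It shows that a bar
    is never satisfied for lack of paths. *)
Lemma path_through {C : Type} (a : list C) (c : C) : exists P, bpath P /\ P a.
Proof.
  set (B := fun n => a ++ repeat c n).
  assert (EB : forall i j, i <= j -> ext (B j) (B i)).
  { intros i j H. exists (repeat c (j - i)). unfold B.
    rewrite <- app_assoc, <- repeat_app. do 2 f_equal. lia. }
  exists (fun x => exists n, ext (B n) x). split; [split|].
  - intros x y [i Hi] [j Hj]. apply (ext_comparable (B (Nat.max i j)));
      [apply (ext_trans _ (B i)) | apply (ext_trans _ (B j))]; auto; apply EB; lia.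
  (* [B (length x)] is at least as long as [x], so comparability of the two makes [x] one of its
     initial segments. *)
  - intros Q HQ HPQ x Hx. exists (length x).
    destruct (HQ x (B (length x)) Hx) as [K|K]; [ | |exact K].
    + apply HPQ. exists (length x). apply ext_refl.
    + replace (B (length x)) with x; [apply ext_refl|]. apply (ext_length_eq _ _ K).
      unfold B. rewrite length_app, repeat_length. lia.
  - exists 0. exists []. reflexivity.
Qed.

(** For an order-preserving involution the preimage of a set is its image, so chains, and with them
    maximal chains, go to chains and maximal chains. *)
Lemma bpath_comp {C : Type} (h : list C -> list C) (P : list C -> Prop) :
  (forall x, h (h x) = x) -> (forall x y, ext x y -> ext (h x) (h y)) ->
  bpath P -> bpath (fun x => P (h x)).
Proof.
  intros hK hE [Hc Hm].
  assert (chain_comp : forall Q, chain Q -> chain (fun x => Q (h x))).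
  { intros Q HQ x y Hx Hy. rewrite <- (hK x), <- (hK y).
    destruct (HQ _ _ Hx Hy); auto. }
  split; [apply chain_comp, Hc|]. intros Q HQ HPQ x Hx.
  apply (Hm (fun x => Q (h x))); [apply chain_comp, HQ | | rewrite hK; exact Hx].
  intros y Hy. apply HPQ. rewrite hK. exact Hy.
Qed.

Lemma good_comp {C X : Type} (h : list C -> list C) (f : list C -> nat -> option X) :
  (forall x, h (h x) = x) -> (forall x y, ext x y -> ext (h x) (h y)) ->
  good f -> good (fun x n => f (h x) n).
Proof.
  intros hK hE [Hm Hc]. split.
  - intros x y Hxy n v H. exact (Hm _ _ (hE _ _ Hxy) _ _ H).
  - intros P HP n. destruct (Hc _ (bpath_comp h P hK hE HP) n) as [x [Px [v Hv]]].
    exists (h x). split; [exact Px|]. exists v. rewrite hK. exact Hv.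
Qed.

(** * Truncations and constants *)

Local Arguments lev : simpl never.
Local Arguments A : simpl never.
Local Arguments Col : simpl never.

(** The projection with its type stated through [Col k] and [A k], so that the recursion [lev] stays
    folded; [mkA] does the same for the constructor. *)
Definition fap {k : nat} (f : A (S k)) : list (Col k) -> nat -> option (A k) := proj1_sig f.

Definition mkA {k : nat} (f : list (Col k) -> nat -> option (A k)) (H : good f) : A (S k) :=
  exist _ f H.

Lemma fap_good {k : nat} (f : A (S k)) : good (fap f).
Proof. exact (proj2_sig f). Qed.

(** Objects carry a proof of [good], so extensionality also requires proof irrelevance. It is what
    lets the action below be compared by plain equality. *)
Lemma fap_inj {k : nat} (f g : A (S k)) : (forall x n, fap f x n = fap g x n) -> f = g.
Proof.
  destruct f as [f Hf], g as [g Hg]. intros H.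
  assert (E : f = g) by (do 2 (apply functional_extensionality; intro); apply H).
  subst g. f_equal. apply proof_irrelevance.
Qed.

(** The type-[k] object that returns [n] after [k] applications, whatever the arguments and the
    node. *)
Fixpoint cst (n k : nat) : A k :=
  match k return A k with
  | 0 => n
  | S k' => mkA (fun _ _ => Some (cst n k')) (good_const _)
  end.

Fixpoint col0 (k : nat) : Col k :=
  match k return Col k with
  | 0 => 0
  | S k' => (col0 k', cst 0 (S k'))
  end.

Lemma trunc_refl k (c : Col k) : trunc k k c = Some c.
Proof.
  destruct k; simpl.
  - reflexivity.
  - destruct (Nat.eq_dec k k) as [e|]; [|congruence].
    rewrite (UIP_dec Nat.eq_dec e eq_refl). reflexivity.
Qed.

Lemma trunc_S j i (c : Col (S j)) : S j <> i -> trunc (S j) i c = trunc j i (fst c).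
Proof.
  intros H. cbn [trunc]. destruct (Nat.eq_dec (S j) i); [contradiction | reflexivity].
Qed.

Lemma trunc_lt j i (c : Col j) : j < i -> trunc j i c = None.
Proof.
  induction j; intros H.
  - cbn [trunc]. destruct (Nat.eq_dec 0 i); [lia | reflexivity].
  - rewrite trunc_S by lia. apply IHj. lia.
Qed.

Lemma trunc_some j i (c : Col j) : i <= j -> exists u, trunc j i c = Some u.
Proof.
  induction j; intros H.
  - replace i with 0 by lia. eexists. apply trunc_refl.
  - destruct (Nat.eq_dec (S j) i) as [<-|N].
    + eexists. apply trunc_refl.
    + rewrite trunc_S by exact N. apply IHj. lia.
Qed.

Lemma trunc_pred j i (c : Col j) (u : Col (S i)) :
  trunc j (S i) c = Some u -> trunc j i c = Some (fst u).
Proof.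
  induction j; intros H.
  - rewrite trunc_lt in H by lia. discriminate.
  - destruct (Nat.eq_dec j i) as [<-|N].
    + rewrite trunc_refl in H. injection H as <-.
      rewrite trunc_S by lia. apply trunc_refl.
    + rewrite trunc_S in H by lia. destruct (Nat.lt_ge_cases j (S i)) as [L|L].
      * rewrite trunc_lt in H by exact L. discriminate.
      * rewrite trunc_S by lia. apply IHj, H.
Qed.

(** Lower truncations factor through higher ones: descend from [m] to [i] one component at a time
    with [trunc_pred]. *)
Lemma trunc_eq_le j m i (c c' : Col j) :
  i <= m -> m <= j -> trunc j m c = trunc j m c' -> trunc j i c = trunc j i c'.
Proof.
  intros H. induction H as [|m H IH]; intros Hj E; [exact E|].
  apply IH; [lia|]. destruct (trunc_some j (S m) c Hj) as [u Hu].
  rewrite (trunc_pred _ _ _ _ Hu). symmetry. apply trunc_pred. congruence.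
Qed.

Lemma truncs_some j i xs : i <= j -> exists ys, truncs j i xs = Some ys /\ length ys = length xs.
Proof.
  intros H. induction xs as [|c xs [ys [E L]]]; simpl.
  - exists []. auto.
  - destruct (trunc_some j i c H) as [u ->]. rewrite E. exists (u :: ys). simpl. auto.
Qed.

Lemma truncs_app j i xs zs ys : truncs j i (xs ++ zs) = Some ys ->
  exists us vs, truncs j i xs = Some us /\ truncs j i zs = Some vs /\ ys = us ++ vs.
Proof.
  revert ys. induction xs as [|c xs IH]; simpl; intros ys H.
  - exists [], ys. auto.
  - destruct (trunc j i c) as [u|]; [|discriminate].
    destruct (truncs j i (xs ++ zs)) as [ws|]; [|discriminate].
    destruct (IH _ eq_refl) as (us & vs & -> & -> & ->).
    injection H as <-. exists (u :: us), vs. auto.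
Qed.

Lemma truncs_ext j i (x y : list (Col j)) u : i <= j -> ext x y -> truncs j i y = Some u ->
  exists v, truncs j i x = Some v /\ ext v u.
Proof.
  intros H [z ->] E. destruct (truncs_some j i (y ++ z) H) as [v [Hv _]].
  exists v. split; [exact Hv|].
  destruct (truncs_app _ _ _ _ _ Hv) as (us & vs & E1 & _ & ->).
  exists vs. congruence.
Qed.

Lemma truncs_firstn j i n xs ys : truncs j i xs = Some ys ->
  truncs j i (firstn n xs) = Some (firstn n ys).
Proof.
  revert n ys. induction xs as [|c xs IH]; simpl; intros n ys H.
  - injection H as <-. rewrite !firstn_nil. reflexivity.
  - destruct (trunc j i c) as [u|] eqn:Ec; [|discriminate].
    destruct (truncs j i xs) as [ws|]; [|discriminate]. injection H as <-.
    destruct n; [reflexivity|]. simpl. rewrite Ec, (IH n _ eq_refl). reflexivity.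
Qed.

Lemma truncs_nth j i n xs ys c : truncs j i xs = Some ys -> nth_error xs n = Some c ->
  trunc j i c = nth_error ys n.
Proof.
  revert n ys. induction xs as [|c0 xs IH]; simpl; intros n ys H Hn.
  - destruct n; discriminate.
  - destruct (trunc j i c0) as [u|] eqn:Ec; [|discriminate].
    destruct (truncs j i xs) as [ws|]; [|discriminate]. injection H as <-.
    destruct n; simpl in *; [congruence | apply (IH n); auto].
Qed.

(** * Beth forcing *)

(** The application clause of [eval], isolated as an operation on values so that it can be rewritten
    without dependent matching. *)
Definition apV (s : nat) (a : Node s) (d : Val) (n : nat) : option Val :=
  match d with
  | existT _ k g =>
      match k return A k -> option Val with
      | 0 => fun _ => None
      | S k' => fun g =>
          match truncs (s - 1) k' a with
          | Some a' => option_map (existT A k') (fap g a' n)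
          | None => None
          end
      end g
  end.

Lemma eval_tAp s rho (a : Node s) f t :
  eval s rho a (tAp f t) =
  match eval s rho a f, option_map asnat (eval s rho a t) with
  | Some d, Some (Some n) => apV s a d n
  | _, _ => None
  end.
Proof. cbn [eval]. destruct (eval s rho a f) as [[k g]|]; reflexivity. Qed.

Lemma apV_some s (a : Node s) d n e : apV s a d n = Some e ->
  exists k (g : A (S k)) u v, d = existT A (S k) g /\ truncs (s - 1) k a = Some u /\
    fap g u n = Some v /\ e = existT A k v.
Proof.
  destruct d as [[|k] g]; cbn [apV]; [discriminate|].
  destruct (truncs (s - 1) k a) as [u|] eqn:E1; [|discriminate].
  destruct (fap g u n) as [v|] eqn:E2; [|discriminate].
  intros H. injection H as <-. exists k, g, u, v. auto.
Qed.

Lemma eval_bound s rho (a : Node s) t d : tmax t <= s ->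
  (forall v, In v (tvars t) -> projT1 (rho v) <= s) ->
  eval s rho a t = Some d -> projT1 d <= s.
Proof.
  revert d. induction t; cbn [tmax tvars]; intros d Ht Hv E; [cbn [eval] in E .. |].
  - injection E as <-. apply Hv. simpl. auto.
  - injection E as <-. simpl. lia.
  - destruct n; [discriminate|]. injection E as <-. simpl. lia.
  - destruct (option_map asnat _) as [[n|]|]; try discriminate.
    injection E as <-. simpl. lia.
  - destruct (option_map asnat (eval s rho a t1)) as [[n|]|]; try discriminate.
    destruct (option_map asnat (eval s rho a t2)) as [[n'|]|]; try discriminate.
    injection E as <-. simpl. lia.
  - destruct (option_map asnat (eval s rho a t1)) as [[n|]|]; try discriminate.
    destruct (option_map asnat (eval s rho a t2)) as [[n'|]|]; try discriminate.
    injection E as <-. simpl. lia.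
  - destruct (eval s rho a t) as [[k x]|]; [|discriminate].
    injection E as <-. exact (IHt _ Ht Hv eq_refl).
  - assert (B : forall d, eval s rho a t1 = Some d -> projT1 d <= s).
    { intros e. apply IHt1; [lia|]. intros v Hin. apply Hv, in_app_iff. auto. }
    rewrite eval_tAp in E. destruct (eval s rho a t1) as [d1|]; [|discriminate].
    destruct (option_map asnat _) as [[n|]|]; try discriminate.
    destruct (apV_some _ _ _ _ _ E) as (k & g & u & v & -> & _ & _ & ->).
    specialize (B _ eq_refl). simpl in *. lia.
Qed.

(* Without the bounds this fails: [truncs] is defined at the root even for levels above [s - 1],
   where it is undefined at every other node. *)
Lemma eval_mono s rho (a b : Node s) t d : tmax t <= s ->
  (forall v, In v (tvars t) -> projT1 (rho v) <= s) ->
  ext b a -> eval s rho a t = Some d -> eval s rho b t = Some d.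
Proof.
  intros Ht Hv H. revert d. induction t; intros d E; cbn [tmax tvars] in *;
    [cbn [eval] in * .. |]; auto.
  - destruct (eval s rho a t) as [e|]; [|discriminate].
    rewrite (IHt Ht Hv _ eq_refl). exact E.
  - setoid_rewrite in_app_iff in Hv.
    destruct (eval s rho a t1) as [e1|]; [|discriminate].
    rewrite (IHt1 ltac:(lia) ltac:(auto) _ eq_refl).
    destruct (eval s rho a t2) as [e2|].
    + rewrite (IHt2 ltac:(lia) ltac:(auto) _ eq_refl). exact E.
    + simpl in E. destruct (asnat e1); discriminate.
  - setoid_rewrite in_app_iff in Hv.
    destruct (eval s rho a t1) as [e1|]; [|discriminate].
    rewrite (IHt1 ltac:(lia) ltac:(auto) _ eq_refl).
    destruct (eval s rho a t2) as [e2|].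
    + rewrite (IHt2 ltac:(lia) ltac:(auto) _ eq_refl). exact E.
    + simpl in E. destruct (asnat e1); discriminate.
  - destruct (eval s rho a t) as [e|]; [|discriminate].
    rewrite (IHt Ht Hv _ eq_refl). exact E.
  - setoid_rewrite in_app_iff in Hv.
    rewrite eval_tAp in *. destruct (eval s rho a t1) as [d1|] eqn:E1; [|discriminate].
    assert (Hk : projT1 d1 <= s) by
      (apply (eval_bound s rho a t1 _ ltac:(lia) ltac:(auto) E1)).
    rewrite (IHt1 ltac:(lia) ltac:(auto) _ eq_refl).
    destruct (eval s rho a t2) as [e2|]; [|discriminate].
    rewrite (IHt2 ltac:(lia) ltac:(auto) _ eq_refl).
    simpl in *. destruct (asnat e2) as [n|]; [|discriminate].
    destruct (apV_some _ _ _ _ _ E) as (k & g & u & v & -> & Eu & Ev & ->).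
    simpl in Hk.
    destruct (truncs_ext (s - 1) k b a u ltac:(lia) H Eu) as [w [Ew Hw]].
    cbn [apV]. rewrite Ew, (proj1 (fap_good g) u w Hw _ _ Ev). reflexivity.
Qed.

Lemma bar_here s (a : Node s) (R : Node s -> Prop) : R a -> bar a R.
Proof. intros H P _ Pa. exists a. auto using ext_refl. Qed.

(** A path through [b] also passes through [a], hence meets [R] at some [c] comparable with [b]; the
    later of [b] and [c] serves. *)
Lemma bar_mono s (a b : Node s) (R : Node s -> Prop) :
  (forall c d, ext d c -> R c -> R d) -> ext b a -> bar a R -> bar b R.
Proof.
  intros HR Hba HA P HP Pb.
  destruct (HA P HP (path_prefix _ _ _ HP Pb Hba)) as (c & Pc & Hca & Rc).
  destruct (proj1 HP _ _ Pc Pb) as [K|K]; [exists c | exists b]; eauto using ext_refl.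
Qed.

Lemma bar_impl s (a : Node s) (R R' : Node s -> Prop) :
  (forall b, R b -> R' b) -> bar a R -> bar a R'.
Proof. intros H HA P HP Pa. destruct (HA P HP Pa) as (b & ? & ? & ?). exists b. auto. Qed.

Lemma bar_bar s (a : Node s) (R : Node s -> Prop) : bar a (fun b => bar b R) -> bar a R.
Proof.
  intros H P HP Pa. destruct (H P HP Pa) as (b & Pb & Hba & Hb).
  destruct (Hb P HP Pb) as (c & Pc & Hcb & Rc). exists c. eauto using ext_trans.
Qed.

Lemma dom_vtype v d : dom v d -> projT1 d = vtype v.
Proof. destruct v; simpl; tauto. Qed.

Definition env_le (s : nat) (p : formula) (rho : var -> Val) : Prop :=
  forall v, free v p -> projT1 (rho v) <= s.

Lemma env_le_upd s v p rho d : vtype v <= s -> dom v d ->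
  (forall w, v <> w /\ free w p -> projT1 (rho w) <= s) -> env_le s p (upd rho v d).
Proof.
  intros Hv Hd H w Hw. unfold upd. destruct (var_eq_dec w v) as [->|N].
  - rewrite (dom_vtype _ _ Hd). exact Hv.
  - apply H. auto.
Qed.

Lemma forces_mono s p rho (a b : Node s) : tbnd s p -> env_le s p rho ->
  ext b a -> forces s p rho a -> forces s p rho b.
Proof.
  unfold env_le. revert rho a b. induction p; cbn [forces tbnd free];
    intros rho a b HB HE Hba; auto.
  - apply bar_mono; [|exact Hba]. intros c d Hdc (e & E1 & E2). exists e.
    split; (eapply eval_mono; [| | exact Hdc |]); eauto; tauto.
  (* The node [g] is an initial segment of the current one, so it remains one at every later
     node. *)
  - apply bar_mono; [|exact Hba]. intros c d Hdc (m & E1 & g & Hcg & L & F). exists m.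
    split; [eapply eval_mono; [| | exact Hdc |]; eauto; tauto |].
    exists g. eauto using ext_trans.
  - intros [F1 F2]. split; [eapply IHp1 | eapply IHp2]; eauto; tauto.
  - apply bar_mono; [|exact Hba].
    intros c d Hdc [F|F]; [left; eapply IHp1 | right; eapply IHp2]; eauto; tauto.
  - intros F c Hcb. apply F. eauto using ext_trans.
  - intros F d Hd. apply (IHp (upd rho v d) a); auto; [tauto|].
    apply env_le_upd; tauto.
  - apply bar_mono; [|exact Hba]. intros c d Hdc (e & He & F). exists e.
    split; [exact He|]. apply (IHp (upd rho v e) c); auto; [tauto|].
    apply env_le_upd; tauto.
Qed.

(** The Beth property: a formula forced on a bar is already forced. Clauses beginning with a bar
    collapse by [bar_bar]. For an implication, the premise is carried by monotonicity to the later
    of the two comparable nodes. *)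
Lemma forces_local s p rho (a : Node s) : tbnd s p -> env_le s p rho ->
  bar a (fun b => forces s p rho b) -> forces s p rho a.
Proof.
  unfold env_le. revert rho a. induction p; cbn [forces tbnd free]; intros rho a HB HE F;
    try (apply bar_bar; exact F).
  (* Some path through [a] exists, so a bar for [Fbot] is contradictory. *)
  - destruct (path_through a (col0 (s - 1))) as [P [HP Pa]].
    destruct (F P HP Pa) as (b & _ & _ & []).
  - split; [apply IHp1 | apply IHp2]; try tauto; try (intros; apply HE; tauto);
      revert F; apply bar_impl; tauto.
  - intros b Hba Fb. apply IHp2; try tauto; [intros; apply HE; tauto|].
    intros P HP Pb. destruct (F P HP (path_prefix _ _ _ HP Pb Hba)) as (c & Pc & Hca & Fc).
    destruct (proj1 HP _ _ Pc Pb) as [K|K]; [exists c | exists b];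
      repeat split; auto using ext_refl; apply Fc; auto using ext_refl.
    apply (forces_mono s p1 rho b); auto; [tauto | intros v Hv; apply HE; tauto].
  - intros d Hd. apply IHp; [tauto | apply env_le_upd; tauto |].
    revert F. apply bar_impl. auto.
Qed.

Lemma eval_env s rho rho' (a : Node s) t :
  (forall v, In v (tvars t) -> rho v = rho' v) -> eval s rho a t = eval s rho' a t.
Proof.
  induction t; cbn [eval tvars]; intros H; auto;
    try (setoid_rewrite in_app_iff in H; rewrite IHt1, IHt2 by auto; reflexivity);
    try (rewrite IHt by auto; reflexivity).
  rewrite H; simpl; auto.
Qed.

Lemma forces_env s p rho rho' (a : Node s) :
  (forall v, free v p -> rho v = rho' v) -> forces s p rho a -> forces s p rho' a.
Proof.
  revert rho rho' a. induction p; cbn [forces free]; intros rho rho' a H.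
  - apply bar_impl. intros b (d & E1 & E2). exists d.
    rewrite <- !(eval_env s rho rho') by auto. auto.
  - apply bar_impl. intros b (m & E1 & g & Hg & L & F). exists m.
    rewrite <- (eval_env s rho rho') by auto. split; [exact E1|].
    exists g. repeat split; auto. apply (IHp rho); auto.
  - auto.
  - intros [F1 F2]. split; [eapply IHp1 | eapply IHp2]; eauto.
  - apply bar_impl. intros b [F|F]; [left; eapply IHp1 | right; eapply IHp2]; eauto.
  - intros F b Hb F1. apply (IHp2 rho); auto. apply F; auto.
    apply (IHp1 rho'); auto. intros v Hv. symmetry. auto.
  - intros F d Hd. apply (IHp (upd rho v d)); auto.
    intros w Hw. unfold upd. destruct (var_eq_dec w v); auto.
  - apply bar_impl. intros b (d & Hd & F). exists d. split; [exact Hd|].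
    apply (IHp (upd rho v d)); auto.
    intros w Hw. unfold upd. destruct (var_eq_dec w v); auto.
Qed.

(** * Automorphisms of the Beth model *)

(* [tau i j] permutes the [i]-th entries of the [j]-th component of a node. *)
Section Automorphism.

Variable tau : nat -> forall j, A j -> A j.
Hypothesis tauK : forall i j x, tau i j (tau i j x) = x.

Fixpoint colact (i k : nat) : Col k -> Col k :=
  match k return Col k -> Col k with
  | 0 => tau i 0
  | S k' => fun c => (colact i k' (fst c), tau i (S k') (snd c))
  end.

(** The index [i] is the position of the head of the list within the whole node; actions on nodes
    start at 0. *)
Fixpoint nact (k i : nat) (xs : list (Col k)) : list (Col k) :=
  match xs with
  | [] => []
  | c :: r => colact i k c :: nact k (S i) r
  end.

Lemma colactK i k c : colact i k (colact i k c) = c.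
Proof.
  induction k; [exact (tauK i 0 c)|]. destruct c as [c x]. cbn [colact fst snd].
  rewrite IHk, tauK. reflexivity.
Qed.

Lemma nactK k i xs : nact k i (nact k i xs) = xs.
Proof.
  revert i. induction xs as [|c xs IH]; intros i; simpl; [reflexivity|].
  rewrite colactK, IH. reflexivity.
Qed.

Lemma nact_length k i xs : length (nact k i xs) = length xs.
Proof. revert i. induction xs; intros i; simpl; auto. Qed.

Lemma nact_ext k i xs ys : ext xs ys -> ext (nact k i xs) (nact k i ys).
Proof.
  intros [zs ->]. revert i. induction ys as [|c ys IH]; intros i; simpl.
  - eexists. reflexivity.
  - destruct (IH (S i)) as [us ->]. exists us. reflexivity.
Qed.

Lemma nact_nth k i xs n :
  nth_error (nact k i xs) n = option_map (colact (i + n) k) (nth_error xs n).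
Proof.
  revert i n. induction xs as [|c xs IH]; intros i [|n]; simpl; auto.
  - rewrite Nat.add_0_r. reflexivity.
  - rewrite IH. do 2 f_equal. lia.
Qed.

Lemma colact_last i k c : lastc k (colact i k c) = tau i k (lastc k c).
Proof. destruct k; reflexivity. Qed.

Lemma colact_trunc i j k c : trunc j k (colact i j c) = option_map (colact i k) (trunc j k c).
Proof.
  induction j.
  - destruct k; [rewrite !trunc_refl; reflexivity | rewrite !trunc_lt by lia; reflexivity].
  - destruct (Nat.eq_dec (S j) k) as [<-|N].
    + rewrite !trunc_refl. reflexivity.
    + rewrite !trunc_S by exact N. apply IHj.
Qed.

Lemma nact_truncs j k i xs :
  truncs j k (nact j i xs) = option_map (nact k i) (truncs j k xs).
Proof.
  revert i. induction xs as [|c xs IH]; intros i; simpl; [reflexivity|].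
  rewrite colact_trunc, IH. destruct (trunc j k c); [|reflexivity].
  destruct (truncs j k xs); reflexivity.
Qed.

(** Conjugation by the action on nodes: move the argument node, apply [f], move the value. The
    inverse is the action itself, as [tau] is involutive. *)
Fixpoint act (k : nat) : A k -> A k :=
  match k return A k -> A k with
  | 0 => fun x => x
  | S k' => fun f =>
      mkA (fun x n => option_map (act k') (fap f (nact k' 0 x) n))
        (good_map (act k') _
           (good_comp (nact k' 0) _ (nactK k' 0) (nact_ext k' 0) (fap_good f)))
  end.

Lemma fap_act k (f : A (S k)) x n :
  fap (act (S k) f) x n = option_map (act k) (fap f (nact k 0 x) n).
Proof. reflexivity. Qed.

Lemma actK k x : act k (act k x) = x.
Proof.
  induction k; [reflexivity|]. apply fap_inj. intros y n.
  rewrite !fap_act, nactK. destruct (fap x y n); simpl; [rewrite IHk|]; reflexivity.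
Qed.

Lemma act_Khat k : act (S k) (Khat k) = Khat k.
Proof.
  induction k; apply fap_inj; intros y n; rewrite fap_act; [reflexivity|].
  cbn. f_equal. exact IHk.
Qed.

Lemma fap_Shat k (f : A (S k)) x n : fap (Shat (S k) f) x n = option_map (Shat k) (fap f x n).
Proof. reflexivity. Qed.

Lemma act_Shat k x : act k (Shat k x) = Shat k (act k x).
Proof.
  induction k; [reflexivity|]. apply fap_inj. intros y n.
  rewrite fap_Shat, !fap_act, fap_Shat.
  destruct (fap x (nact k 0 y) n); simpl; [rewrite IHk|]; reflexivity.
Qed.

Definition actV (d : Val) : Val := existT A (projT1 d) (act (projT1 d) (projT2 d)).

Lemma actVK d : actV (actV d) = d.
Proof. destruct d as [k x]. unfold actV. simpl. rewrite actK. reflexivity. Qed.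

Lemma asnat_actV d : asnat (actV d) = asnat d.
Proof. destruct d as [[|k] x]; reflexivity. Qed.

Lemma apV_act s (a : Node s) d n :
  apV s (nact (s - 1) 0 a) (actV d) n = option_map actV (apV s a d n).
Proof.
  destruct d as [[|k] g]; [reflexivity|]. unfold actV at 1. cbn [apV projT1 projT2].
  rewrite nact_truncs. destruct (truncs (s - 1) k a) as [u|]; [|reflexivity].
  cbn [option_map]. rewrite fap_act, nactK. destruct (fap g u n); reflexivity.
Qed.

(** Every operation of the model commutes with the action. The equation is between options, so
    undefined values correspond too. *)
Lemma eval_act s rho (a : Node s) t :
  eval s (fun v => actV (rho v)) (nact (s - 1) 0 a) t = option_map actV (eval s rho a t).
Proof.
  assert (N : forall o, option_map asnat (option_map actV o) = option_map asnat o).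
  { intros [d|]; cbn [option_map]; [rewrite asnat_actV|]; reflexivity. }
  induction t; try rewrite !eval_tAp; cbn [eval].
  - reflexivity.
  - reflexivity.
  - destruct n; [reflexivity|]. simpl. unfold actV. cbn [projT1 projT2].
    rewrite act_Khat. reflexivity.
  - rewrite IHt, N. destruct (option_map asnat _) as [[n|]|]; reflexivity.
  - rewrite IHt1, IHt2, !N. destruct (option_map asnat _) as [[n|]|]; try reflexivity.
    destruct (option_map asnat _) as [[n'|]|]; reflexivity.
  - rewrite IHt1, IHt2, !N. destruct (option_map asnat _) as [[n|]|]; try reflexivity.
    destruct (option_map asnat _) as [[n'|]|]; reflexivity.
  - rewrite IHt. destruct (eval s rho a t) as [[k x]|]; [|reflexivity].
    unfold actV. cbn [option_map projT1 projT2]. rewrite act_Shat. reflexivity.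
  - rewrite IHt1, IHt2, !N. destruct (eval s rho a t1) as [d|]; [|reflexivity].
    destruct (option_map asnat _) as [[n|]|]; try reflexivity. apply apV_act.
Qed.

Lemma lawlikeP_act d : lawlikeP d -> lawlikeP (actV d).
Proof.
  destruct d as [[|k] f]; [exact (fun H => H)|]. intros H n. destruct (H n) as [v Hv].
  exists (act k v). change (fap (act (S k) f) [] n = Some (act k v)).
  change (fap f [] n = Some v) in Hv. rewrite fap_act. simpl. rewrite Hv. reflexivity.
Qed.

Lemma bij_comp {X : Type} (h h' : X -> X) : bij h -> bij h' -> bij (fun x => h (h' x)).
Proof.
  intros [g [H1 H2]] [g' [H1' H2']]. exists (fun x => g' (g x)).
  split; intros; congruence.
Qed.

(** Conjugation replaces the bijection [xi n] by [act k] after [xi n] after [tau n k]. This is where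
    the action must go entry by entry: the value at [n] still depends only on entry [n]. *)
Lemma lawlessP_act d : lawlessP d -> lawlessP (actV d).
Proof.
  destruct d as [[|k] f]; [exact (fun H => H)|]. intros [xi [Hb Hf]].
  exists (fun n v => act k (xi n (tau n k v))). split.
  - intros n. apply (bij_comp (act k) (fun v => xi n (tau n k v))).
    + exists (act k). split; apply actK.
    + apply (bij_comp (xi n) (tau n k)); [apply Hb|]. exists (tau n k). split; apply tauK.
  - intros x n. change (list (Col k)) in x. change (fap (act (S k) f) x n =
      match nth_error x n with
      | Some c => Some (act k (xi n (tau n k (lastc k c)))) | None => None end).
    rewrite fap_act. pose proof (Hf (nact k 0 x) n) as E.
    change (fap f (nact k 0 x) n = match nth_error (nact k 0 x) n with
      | Some c => Some (xi n (lastc k c)) | None => None end) in E.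
    rewrite E, nact_nth. destruct (nth_error x n); [|reflexivity].
    simpl. rewrite colact_last. reflexivity.
Qed.

Lemma dom_act v d : dom v d -> dom v (actV d).
Proof.
  destruct v as [i|[| |] n i]; cbn [dom]; [auto | intros (H1 & H2 & H3) ..];
    (split; [exact H1 | split; [exact H2|]]); auto using lawlikeP_act, lawlessP_act.
Qed.

Lemma upd_act rho v d :
  (fun w => actV (upd rho v d w)) = upd (fun w => actV (rho w)) v (actV d).
Proof.
  apply functional_extensionality. intros w. unfold upd.
  destruct (var_eq_dec w v); reflexivity.
Qed.

Lemma bar_act s (a : Node s) (R R' : Node s -> Prop) :
  (forall b, R b -> R' (nact (s - 1) 0 b)) -> bar a R -> bar (nact (s - 1) 0 a) R'.
Proof.
  intros HR HA P HP Pa.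
  destruct (HA _ (bpath_comp _ P (nactK _ 0) (nact_ext _ 0) HP) Pa) as (b & Pb & Hb & Rb).
  exists (nact (s - 1) 0 b). auto using nact_ext.
Qed.

(** The action is an automorphism: it preserves extension, length, paths, domains and values, which
    are all that the forcing clauses mention. *)
Lemma forces_act s p rho (a : Node s) :
  forces s p rho a -> forces s p (fun v => actV (rho v)) (nact (s - 1) 0 a).
Proof.
  (* Acting twice is the identity, so one direction for [q] gives the other; the implication case
     needs it for the premise. *)
  assert (back : forall q,
    (forall rho (a : Node s), forces s q rho a ->
       forces s q (fun v => actV (rho v)) (nact (s - 1) 0 a)) ->
    forall rho (a : Node s), forces s q (fun v => actV (rho v)) a ->
       forces s q rho (nact (s - 1) 0 a)).
  { intros q IH r c F. apply IH in F. revert F. apply forces_env.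
    intros v _. apply actVK. }
  revert rho a. induction p; cbn [forces]; intros rho a.
  - apply bar_act. intros b (d & E1 & E2). exists (actV d). rewrite !eval_act, E1, E2. auto.
  - apply bar_act. intros b (m & E & g & Hg & L & F). exists m. rewrite eval_act, E.
    split; [reflexivity|]. exists (nact (s - 1) 0 g). rewrite nact_length.
    auto using nact_ext.
  - auto.
  - intros [F1 F2]. auto.
  - apply bar_act. intros b [F|F]; auto.
  - intros F b Hb F1. rewrite <- (nactK (s - 1) 0 b). apply IHp2, F.
    + rewrite <- (nactK (s - 1) 0 a). apply nact_ext, Hb.
    + apply back; auto.
  - intros F d Hd. rewrite <- (actVK d), <- upd_act. apply IHp, F, dom_act, Hd.
  - apply bar_act. intros b (d & Hd & F). exists (actV d).
    split; [apply dom_act, Hd|]. rewrite <- upd_act. apply IHp, F.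
Qed.

(** An object of type [k] reads only the components below [k] of a node and returns objects of lower
    type. Hence the strict bound on components and the non-strict one on types. *)
Lemma act_low m : (forall i j x, j < m -> tau i j x = x) -> forall k x, k <= m -> act k x = x.
Proof.
  intros H. assert (HC : forall i k c, k < m -> colact i k c = c).
  { intros i. induction k; intros c Hk; [exact (H i 0 c Hk)|]. destruct c as [c x].
    cbn [colact fst snd]. rewrite IHk, H by lia. reflexivity. }
  assert (HN : forall k xs i, k < m -> nact k i xs = xs).
  { intros k xs. induction xs; intros i Hk; simpl; [|rewrite HC, IHxs]; auto. }
  induction k; intros x Hk; [reflexivity|]. apply fap_inj. intros y n.
  rewrite fap_act, HN by lia. destruct (fap x y n); simpl; [rewrite IHk by lia|]; reflexivity.
Qed.

End Automorphism.

(** * The involution exchanging two nodes of equal length *)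

Definition swap {X : Type} (u v x : X) : X :=
  if excluded_middle_informative (x = u) then v
  else if excluded_middle_informative (x = v) then u else x.

Lemma swapK {X : Type} (u v x : X) : swap u v (swap u v x) = x.
Proof.
  unfold swap. repeat destruct excluded_middle_informative; congruence.
Qed.

Lemma swap_l {X : Type} (u v : X) : swap u v u = v.
Proof. unfold swap. destruct excluded_middle_informative; congruence. Qed.

Lemma swap_same {X : Type} (u x : X) : swap u u x = x.
Proof. unfold swap. repeat destruct excluded_middle_informative; congruence. Qed.

(** The last entry of the truncation to [j] is the [j]-th component of a column. Outside the range
    of the two nodes the permutation is the identity. *)
Definition node_swap (k : nat) (a a' : list (Col k)) (i j : nat) : A j -> A j :=
  match nth_error a i, nth_error a' i with
  | Some c, Some c' =>
      match trunc k j c, trunc k j c' with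
      | Some u, Some u' => swap (lastc j u) (lastc j u')
      | _, _ => fun x => x
      end
  | _, _ => fun x => x
  end.

Lemma node_swapK k a a' i j x : node_swap k a a' i j (node_swap k a a' i j x) = x.
Proof.
  unfold node_swap. destruct (nth_error a i), (nth_error a' i); try reflexivity.
  destruct (trunc k j c), (trunc k j c0); try reflexivity. apply swapK.
Qed.

Lemma nact_node_swap k (a a' : list (Col k)) :
  length a = length a' -> nact (node_swap k a a') k 0 a = a'.
Proof.
  intros HL. apply nth_error_ext. intros n. rewrite nact_nth. simpl.
  destruct (nth_error a n) as [c|] eqn:E; simpl.
  - destruct (nth_error a' n) as [c'|] eqn:E'.
    + f_equal.
      (* The columns are matched component by component, by induction on the level at which they are
         truncated. *)
      assert (H : forall j u u', trunc k j c = Some u -> trunc k j c' = Some u' ->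
                    colact (node_swap k a a') n j u = u').
      { assert (HS : forall j u u', trunc k j c = Some u -> trunc k j c' = Some u' ->
                    node_swap k a a' n j (lastc j u) = lastc j u').
        { intros j u u' Hu Hu'. unfold node_swap. rewrite E, E', Hu, Hu'. apply swap_l. }
        induction j; intros u u' Hu Hu'; [exact (HS 0 u u' Hu Hu')|].
        pose proof (IHj _ _ (trunc_pred _ _ _ _ Hu) (trunc_pred _ _ _ _ Hu')) as E1.
        pose proof (HS _ _ _ Hu Hu') as E2. destruct u as [u x], u' as [u' x'].
        exact (f_equal2 pair E1 E2). }
      apply (H k); apply trunc_refl.
    + apply nth_error_None in E'. rewrite <- HL in E'. apply nth_error_None in E'. congruence.
  - apply nth_error_None in E. rewrite HL in E. symmetry. apply nth_error_None, E.
Qed.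

Lemma node_swap_low k m (a a' : list (Col k)) i j x : m <= k ->
  truncs k m a = truncs k m a' -> j <= m -> node_swap k a a' i j x = x.
Proof.
  intros Hm E Hj. unfold node_swap.
  destruct (nth_error a i) as [c|] eqn:Ea, (nth_error a' i) as [c'|] eqn:Ea'; try reflexivity.
  destruct (truncs_some k m a Hm) as [ys [Ey _]].
  assert (Ec : trunc k j c = trunc k j c').
  { apply (trunc_eq_le k m); auto.
    rewrite (truncs_nth _ _ _ _ _ _ Ey Ea). rewrite E in Ey.
    rewrite (truncs_nth _ _ _ _ _ _ Ey Ea'). reflexivity. }
  rewrite <- Ec. destruct (trunc k j c); [apply swap_same | reflexivity].
Qed.

(** The truncation to [m] keeps the components 0 to [m], exactly those visible to objects of type at
    most [S m]. The swap of [a] and [a'] therefore fixes the parameters of [p] and carries [a] to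
    [a']. *)
Lemma forces_truncs s m p rho (a a' : Node s) : m <= s - 1 ->
  (forall v, free v p -> projT1 (rho v) <= S m) ->
  truncs (s - 1) m a = truncs (s - 1) m a' -> length a = length a' ->
  forces s p rho a -> forces s p rho a'.
Proof.
  intros Hm Hv E HL F.
  apply (forces_act _ (node_swapK (s - 1) a a')) in F.
  rewrite nact_node_swap in F by exact HL. revert F. apply forces_env. intros v Hf.
  specialize (Hv v Hf). destruct (rho v) as [k x]. unfold actV. simpl in *.
  rewrite (act_low _ _ (S m)); auto.
  intros i j y Hj. apply (node_swap_low _ m); auto. lia.
Qed.

(** * Kripke's schema in the Beth model *)

Lemma wf_free_ok p v : wf p -> free v p -> var_ok v.
Proof.
  assert (HT : forall t n, tyof t = Some n -> In v (tvars t) -> var_ok v).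
  { induction t; cbn [tyof tvars]; intros k E Hin; try (now destruct Hin).
    - destruct Hin as [->|[]]. destruct v as [i|kd n i]; [exact I|].
      simpl. destruct n; [discriminate | lia].
    - destruct (tyof t); [eauto | discriminate].
    - apply in_app_iff in Hin. destruct (tyof t1) as [[|]|], (tyof t2); try discriminate.
      destruct Hin; eauto.
    - apply in_app_iff in Hin. destruct (tyof t1) as [[|]|], (tyof t2); try discriminate.
      destruct Hin; eauto.
    - destruct (tyof t); [eauto | discriminate].
    - apply in_app_iff in Hin. destruct (tyof t1) as [[|]|], (tyof t2); try discriminate.
      destruct Hin; eauto. }
  induction p; simpl; try tauto.
  - intros (n & E1 & E2) [H|H]; eauto.
  - intros (E & _ & H) [H'|H']; eauto.
Qed.

(** The constants ignore the node, so only definedness matters: the bound on [i + k] ensures that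
    each application has a truncation to work on. *)
Lemma eval_app0 s rho (a : Node s) t n i k : i + k <= s ->
  eval s rho a t = Some (existT A (i + k) (cst n (i + k))) ->
  eval s rho a (app0 t i) = Some (existT A k (cst n k)).
Proof.
  revert k. induction i; intros k Hs E; [exact E|].
  change (app0 t (S i)) with (tAp (app0 t i) tzero). rewrite eval_tAp.
  rewrite (IHi (S k)); [| lia | replace (i + S k) with (S i + k) by lia; exact E].
  cbn [eval option_map asnat apV].
  destruct (truncs_some (s - 1) k a ltac:(lia)) as [u [-> _]]. reflexivity.
Qed.

(* The value is [1] when the node of length [n] below [x] forces [p]; by [forces_truncs] any node
   with the same truncation may be consulted. *)
Definition ks_fun (s m : nat) (p : formula) (rho : var -> Val)
    (x : list (Col m)) (n : nat) : option (A m) :=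
  if n <=? length x then
    Some (cst (if excluded_middle_informative
                    (exists b : Node s, truncs (s - 1) m b = Some (firstn n x) /\ forces s p rho b)
               then 1 else 0) m)
  else None.

(** The value at [n] depends only on [firstn n x], which is stable under extension, and each path
    has a node of length [n]. *)
Lemma ks_fun_good s m p rho : good (ks_fun s m p rho).
Proof.
  unfold ks_fun. split.
  - intros x y Hyx n v. destruct (Nat.leb_spec n (length x)) as [L|L]; [|discriminate].
    rewrite (firstn_ext y x n Hyx L). apply ext_length in Hyx.
    destruct (Nat.leb_spec n (length y)); [auto | lia].
  - intros P HP n. destruct (path_length P (col0 m) HP n) as [x [Px <-]].
    exists x. split; [exact Px|]. rewrite Nat.leb_refl. eauto.
Qed.

Lemma KS_forced s psi : KSinst psi -> lang (Some s) psi ->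
  forall rho, env_ok rho -> forces s psi rho [].
Proof.
  intros (p & m & g & x & _ & Gp & Hm & ->) [Wf Tb] rho Hrho.
  assert (Wp : wf p) by (simpl in Wf; tauto).
  assert (Tp : tbnd s p) by (simpl in Tb; tauto).
  assert (Ms : m <= s) by (simpl in Tb; tauto). clear Wf Tb.
  destruct m as [|m]; [lia|].
  assert (Hv : forall v, free v p -> projT1 (rho v) <= S m).
  { intros v Hf. rewrite (dom_vtype v); [|apply Hrho, (wf_free_ok p); assumption].
    apply (proj1 (sortf_le p (S m))); [lia | exact Hf]. }
  assert (Ep : env_le s p rho) by (intros v Hf; specialize (Hv v Hf); lia).
  set (G := mkA (ks_fun s m p rho) (ks_fun_good s m p rho)).
  set (rhoG := upd rho (vfun KF (S m) g) (existT A (S m) G)).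
  assert (PG : forall a : Node s, forces s p rho a <-> forces s p rhoG a).
  { intros a. split; apply forces_env; intros v Hf; unfold rhoG, upd;
      destruct (var_eq_dec v (vfun KF (S m) g)); congruence. }
  set (T := app0 (tAp (Fv KF (S m) g) (vx x)) (S m - 1)).
  (* At any node of length at least [n], the term [T] at [n] is defined and tells whether the
     initial segment of length [n] forces [p]. Both directions rest on this. *)
  assert (ET : forall n (a : Node s), n <= length a ->
    exists k, eval s (upd rhoG (vnum x) (existT A 0 n)) a T = Some (existT A 0 k) /\
      (k = 1 /\ forces s p rho (firstn n a) \/ k = 0 /\ ~ forces s p rho (firstn n a))).
  { intros n a Hn. destruct (truncs_some (s - 1) m a ltac:(lia)) as [u [Eu Lu]].
    set (Q := exists b : Node s, truncs (s - 1) m b = Some (firstn n u) /\ forces s p rho b).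
    exists (if excluded_middle_informative Q then 1 else 0). split.
    - unfold T. replace (S m - 1) with m by lia.
      apply (eval_app0 _ _ _ _ _ m 0); rewrite Nat.add_0_r; [lia|].
      assert (EG : upd rhoG (vnum x) (existT A 0 n) (vfun KF (S m) g) = existT A (S m) G).
      { unfold rhoG, upd. destruct (var_eq_dec _ (vnum x)); [discriminate|].
        destruct (var_eq_dec _ _); congruence. }
      assert (EX : upd rhoG (vnum x) (existT A 0 n) (vnum x) = existT A 0 n).
      { unfold upd. destruct (var_eq_dec _ _); congruence. }
      rewrite eval_tAp. cbn [eval Fv vx]. rewrite EG, EX.
      cbn [option_map asnat apV]. rewrite Eu.
      change (fap G u n) with (ks_fun s m p rho u n). unfold ks_fun.
      rewrite Lu, (proj2 (Nat.leb_le _ _) Hn). reflexivity.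
    - pose proof (truncs_firstn _ _ n _ _ Eu) as Ef.
      destruct (excluded_middle_informative Q) as [[b [Eb Fb]]|NQ]; [left | right].
      (* Equal truncations have equal lengths, so [b] may be exchanged for [firstn n a]. *)
      + split; [reflexivity|]. revert Fb. apply (forces_truncs s m); [lia | exact Hv | congruence |].
        destruct (truncs_some (s - 1) m b ltac:(lia)) as [w [Ew Lw]].
        destruct (truncs_some (s - 1) m (firstn n a) ltac:(lia)) as [w' [Ew' Lw']].
        congruence.
      + split; [reflexivity|]. intros F. apply NQ. exists (firstn n a). auto. }
  apply bar_here. exists (existT A (S m) G). split; [simpl; repeat split; lia|].
  fold rhoG. fold T. split.
  (* The witness is [length b]: at every later node the initial segment of this length is [b], which
     forces [p], so the value cannot be 0. *)
  - intros b _ Fb. apply PG in Fb. apply bar_here. exists (existT A 0 (length b)).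
    split; [reflexivity|]. intros c Hcb Fc.
    destruct (path_through c (col0 (s - 1))) as [P [HP Pc]].
    destruct (Fc P HP Pc) as (e & _ & Hec & d & E1 & E2).
    pose proof (ext_trans _ _ _ Hec Hcb) as Heb.
    destruct (ET (length b) e (ext_length _ _ Heb)) as (k & Ek & [[-> _]|[_ N]]).
    (* Reading off the numbers with [asnat] avoids inverting an equality of dependent pairs. *)
    + assert (K : option_map asnat (Some (existT A 0 1)) = option_map asnat (Some (existT A 0 0)))
        by (apply f_equal; transitivity (Some d); [congruence | symmetry; exact E2]).
      discriminate K.
    + apply N. rewrite (firstn_ext _ _ _ Heb), firstn_all by lia. exact Fb.
  (* By locality it suffices to find [p] forced on each path. Past the node that supplies [n], go on
     to one of length at least [n], where [T] is defined. Value 0 is excluded, so the initial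
     segment of length [n] forces [p]. *)
  - intros b _ FE. apply PG, (forces_local s p rho b Tp Ep). intros P HP Pb.
    destruct (FE P HP Pb) as (c & Pc & Hcb & d & Hd & Fc).
    destruct d as [k n]. simpl in Hd. subst k.
    destruct (path_extend P (col0 (s - 1)) c n HP Pc) as (e & Pe & Hec & Le).
    exists e. split; [exact Pe|]. split; [exact (ext_trans _ _ _ Hec Hcb)|].
    destruct (ET n e Le) as (k & Ek & [[_ F]|[-> _]]).
    + exact (forces_mono s p rho _ _ Tp Ep (ext_firstn e n) F).
    + exfalso. apply (Fc e Hec), bar_here. exists (existT A 0 0). auto.
Qed.

Theorem theorem10p1 :
  (* (1) LP_s + (C_s) |- (KS_s) *)
  (forall s, 1 <= s -> forall psi, KSinst psi -> lang (Some s) psi ->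
     Prov LPC (lang (Some s)) psi) /\
  (* (2) LP + (C) |- (KS) *)
  (forall psi, KSinst psi -> lang None psi -> Prov LPC (lang None) psi) /\
  (* (3) B_s forces (the universal closure of) every instance of (KS_s) *)
  (forall s, 1 <= s -> forall psi, KSinst psi -> lang (Some s) psi ->
     forall rho, env_ok rho -> forces s psi rho nil).
Proof.
  split; [|split].
  - intros s _ psi. apply KS_derivable.
  - intros psi. apply KS_derivable.
  - intros s _ psi H L. apply (KS_forced s psi H L).
Qed.
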